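(* Let $r\ge 2$ and $S=K[x_0,\dots,x_r]$. Let $I\subset S$ be a homogeneous ideal such that $S/I$ has finite length and the minimal graded free resolution of $S/I$ has the form $$S\longleftarrow S^{m_1}(-d)\longleftarrow S^{m_2}(-d-1)\longleftarrow\cdots\longleftarrow S^{m_r}(-d-r+1)\longleftarrow \bigoplus_{i=1}^{m_{r+1}} S(-d-r-b_i)\longleftarrow 0$$ with all $b_i\ge 0$. Then $$m_1\geq \binom{d+r-1}{r-1}+\binom{d+r-2}{r-1},$$ with equality if and only if $S/I$ is Gorenstein.
   Context: $K$ is a field and $S$ is graded with $\deg x_i=1$. (The hypothesis says that $I$ is generated in degree $d$ by $m_1$ minimal generators, that $S/I$ has ''almost linear resolution'', and that the socle elements of $S/I$ lie in degrees $d+b_i-1$.) *)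

(* Defs.v *)
From HB Require Import structures.
From mathcomp Require Import all_boot all_order all_algebra.
From mathcomp Require Import ring_quotient.
From mathcomp.multinomials Require Import mpoly.

Set Implicit Arguments.
Unset Strict Implicit.
Unset Printing Implicit Defensive.

Import GRing.Theory.
Local Open Scope ring_scope.
Local Open Scope quotient_scope.

Section Modules.
Variable R : comNzRingType.

Definition strict_submod_chain (M : lmodType R) (n : nat)
    (N : nat -> {pred M}) : Prop :=
  (forall i, (i <= n)%N -> submod_closed (N i)) /\
  (forall i, (i < n)%N ->
     {subset N i <= N i.+1} /\ exists2 x, x \in N i.+1 & x \notin N i).

Definition finite_length (M : lmodType R) : Prop :=
  exists l : nat, forall (n : nat) (N : nat -> {pred M}),
    strict_submod_chain n N -> (n <= l)%N.

Definition injective_module (E : lmodType R) : Prop :=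
  forall (M N : lmodType R) (f : {linear M -> N}) (g : {linear M -> E}),
    injective f -> exists h : {linear N -> E}, forall x, h (f x) = g x.

Inductive injective_dim_le : nat -> lmodType R -> Prop :=
| InjectiveDim0 (M : lmodType R) :
    injective_module M -> injective_dim_le 0 M
| InjectiveDimS (n : nat) (M E N : lmodType R)
    (f : {linear M -> E}) (g : {linear E -> N}) :
    injective_module E ->
    injective f ->
    (forall y, g y = 0 <-> exists x, f x = y) ->
    (forall z, exists y, g y = z) ->
    injective_dim_le n N -> injective_dim_le n.+1 M.

(* This is the definition for a Noetherian *local* ring.  It applies to a      *)
(* nonzero finite-length graded quotient of a standard graded polynomial ring  *)
(* over a field, where the positive-degree elements are nilpotent and generate *)
(* the only maximal ideal.                                                     *)
Definition gorenstein_local : Prop :=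
  exists n : nat, injective_dim_le n (R^o : lmodType R).

End Modules.

Section GradedResolutions.
Variables (K : fieldType) (n : nat).
Local Notation S := {mpoly K[n]}.

Definition homogeneous_ideal (I : {pred S}) : Prop :=
  forall (k : nat) (p : S), p \in I -> pihomog mdeg k p \in I.

(* A sequence a = [:: a_1; ...; a_k] of naturals stands for the graded free    *)
(* module S(-a_1) + ... + S(-a_k), realized as column vectors; its j-th basis  *)
(* vector has degree a_j.  Thus a k x l matrix is a degree-0 map               *)
(* S(-c_1) + ... + S(-c_l) -> S(-a_1) + ... + S(-a_k) when its (i, j) entry    *)
(* is homogeneous of degree c_j - a_i (hence 0 if c_j < a_i).                  *)
Definition graded_map (a c : seq nat) (phi : 'M[S]_(size a, size c)) : Prop :=
  forall i j (m : 'X_{1..n}), m \in msupp (phi i j) ->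
    (nth 0 a i + mdeg m)%N = nth 0 c j.

(* The zero constant coefficient says that the entry lies in (x_0, ..., x_r).  *)
Definition minimal_map (k l : nat) (phi : 'M[S]_(k, l)) : Prop :=
  forall i j, (phi i j)@_(0%MM) = 0.

(* F is the sequence of free modules of a minimal graded free resolution of    *)
(* S/I.  As F 0 = S, a vector const_mx p of F 0 is just p, and the second      *)
(* clause says that the cokernel of phi 0 : F 1 -> F 0 is S/I.                 *)
Definition minimal_graded_resolution (I : {pred S}) (F : nat -> seq nat)
    (phi : forall i, 'M[S]_(size (F i), size (F i.+1))) : Prop :=
  [/\ F 0%N = [:: 0%N],
      forall p : S, p \in I <-> exists w : 'cV[S]_(size (F 1%N)),
        phi 0%N *m w = const_mx p,
      forall i (v : 'cV[S]_(size (F i.+1))),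
        phi i *m v = 0 <-> exists w, v = phi i.+1 *m w,
      forall i, graded_map (phi i)
    & forall i, minimal_map (phi i)].

End GradedResolutions.

(* The free modules S, S(-d)^(m 1), S(-d-1)^(m 2), ..., S(-d-r+1)^(m r), and   *)
(* the sum over b_i in b of S(-d-r-b_i); so m_(r+1) is size b, and m i matters *)
(* only for 1 <= i <= r.                                                       *)
Definition almost_linear_twists (r d : nat) (m : nat -> nat) (b : seq nat)
    (i : nat) : seq nat :=
  if i == 0%N then [:: 0%N]
  else if (i <= r)%N then nseq (m i) (d + i.-1)%N
  else if i == r.+1 then [seq (d + r + bi)%N | bi <- b]
  else [::].

(* Main.v *)
Require Import Defs.
From HB Require Import structures.
From mathcomp Require Import all_boot all_order all_algebra.
From mathcomp Require Import ring_quotient.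
From mathcomp.multinomials Require Import mpoly.
From mathcomp Require boolp classical_sets.
From mathcomp Require Import zify ring.

Set Implicit Arguments.
Unset Strict Implicit.
Unset Printing Implicit Defensive.

Import GRing.Theory.
Local Open Scope ring_scope.

(** Write S for the polynomial ring in n = r + 1 variables, A = S/I, and F for
    the given resolution, so that F (r+1) has the twists d + r + b_i.  The theorem
    splits into a numerical part and a characterization of Gorenstein rings, and
    the number of the b_i is what links them.

    Numerics.  In a large degree t the strand of F is an exact sequence of finite
    dimensional vector spaces with zero cokernel, so the alternating sum of the
    dimensions C(t - a + r, r), over all twists a of F, vanishes ([hilbert_sum]).
    As a function of t this sum is a polynomial, hence it is identically zero
    ([twist_sum_eq0]) and may be evaluated in low degrees, where almost all of the
    linear twists d, ..., d + r - 1 are roots of their summands.  The values at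
    d - 1 and at d give
      sum_i C(r + b_i, r) = C(d + r - 1, r) and
      m_1 + sum_i C(r + b_i - 1, r) = C(d + r, r).
    The first identity forces b_i <= d - 1; since C(x + r - 1, r - 1) is the
    fraction r / (r + x) of C(r + x, r), and this fraction decreases with x, both
    identities together give the bound, with equality exactly when there is a
    single b_i ([generator_bound]).

    Socle.  The socle of A corresponds linearly to the fibre of F (r+1) at the
    origin ([socle_correspondence]); hence there is at most one b_i exactly when
    any two elements of the socle of A are proportional ([socle_poly_simple]).  The
    correspondence comes from dividing by one variable at a time: F modulo
    (x_0, ..., x_(j-1)) stays exact in homological degrees greater than j
    ([exact_mod_vars]), and an element w of the socle of coker (phi k) modulo
    (x_0, ..., x_(k-1)) determines an element w' of the next such socle by
    x_k w = phi_k w'.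

    Gorenstein rings.  A is local with nilpotent maximal ideal, and it has
    elements x_1, ..., x_l spanning it, such that the maximal ideal multiplies each
    x_k into the ideal V_(k-1) spanned by x_1, ..., x_(k-1).  Along such a
    filtration Ext^1 of the residue field controls the extension of homomorphisms
    from ideals.  It follows that a module of finite
    injective dimension satisfies the criterion of Baer ([injective_dim_baer]), so
    that if A has finite injective dimension its socle is simple.  Conversely, if
    the socle is simple, ideals of the filtration are their own double
    annihilators ([double_annihilator]), so homomorphisms from the maximal ideal to
    A are multiplications, and the lemma of Zorn makes A injective
    ([socle_simple_injective]).  These are the two directions of [gorensteinP]. *)

(** * Linear relations and the criterion of Baer *)

Section SubmoduleType.
Variables (R : comNzRingType) (V : lmodType R) (P : {pred V}).

(** The closedness proof is kept as a phantom argument so that the closedness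
    instance can be found from the predicate alone. *)
Definition submod_pred of submod_closed P : {pred V} := P.

Variable hP : submod_closed P.

HB.instance Definition _ :=
  GRing.isSubmodClosed.Build R V (submod_pred hP) hP.

Record submod_type := SubmodType {
  submod_val : V; _ : submod_val \in submod_pred hP }.

HB.instance Definition _ := [isSub for submod_val].
HB.instance Definition _ := [Choice of submod_type by <:].
HB.instance Definition _ := [SubChoice_isSubLmodule of submod_type by <:].
End SubmoduleType.

Section LinearRelations.
Variable R : comNzRingType.

(** Partially defined homomorphisms are handled as relations, that is as graphs:
    a graph is a submodule of M * N, and extending a map is enlarging its graph. *)
Definition linear_rel (M N : lmodType R) (G : M -> N -> Prop) : Prop :=
  G 0 0 /\ forall a x y x' y',
    G x y -> G x' y' -> G (a *: x + x') (a *: y + y').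

Definition functional_rel (M N : lmodType R) (G : M -> N -> Prop) : Prop :=
  forall y, G 0 y -> y = 0.

(** With [G] the graph of a homomorphism from an ideal to [M], this says that the
    homomorphism extends to the whole ring. *)
Definition baer (M : lmodType R) : Prop :=
  forall G : (R^o : lmodType R) -> M -> Prop,
    linear_rel G -> functional_rel G ->
    exists w, forall a e, G a e -> e = a *: w.

Section Basic.
Variables (M N : lmodType R) (G : M -> N -> Prop) (hG : linear_rel G).

Lemma linear_relZ a x y : G x y -> G (a *: x) (a *: y).
Proof. by move=> h; have := hG.2 a _ _ _ _ h hG.1; rewrite !addr0. Qed.

Lemma linear_relB x y x' y' : G x y -> G x' y' -> G (x - x') (y - y').
Proof.
by move=> h h'; have := hG.2 (-1) _ _ _ _ h' h; rewrite !scaleN1r ![- _ + _]addrC.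
Qed.

Lemma functional_rel_uniq x y y' :
  functional_rel G -> G x y -> G x y' -> y = y'.
Proof.
move=> hf h h'; apply/eqP; rewrite -subr_eq0; apply/eqP/hf.
by rewrite -(subrr x); apply: linear_relB.
Qed.

Definition adjoin_rel (x0 : M) (y0 : N) (x : M) (y : N) : Prop :=
  exists a, G (x - a *: x0) (y - a *: y0).

Lemma adjoin_relW x0 y0 x y : G x y -> adjoin_rel x0 y0 x y.
Proof. by exists 0; rewrite !scale0r !subr0. Qed.

Lemma adjoin_rel_new x0 y0 : adjoin_rel x0 y0 x0 y0.
Proof. by exists 1; rewrite !scale1r !subrr; exact: hG.1. Qed.

Lemma adjoin_rel_linear x0 y0 : linear_rel (adjoin_rel x0 y0).
Proof.
split; first exact/adjoin_relW/hG.1.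
move=> a x y x' y' [c h] [c' h']; exists (a * c + c').
have := hG.2 a _ _ _ _ h h'.
rewrite !scalerDl !scalerBr !scalerA.
by rewrite [X in G X]addrACA [X in G _ X -> _]addrACA -!opprD.
Qed.

(** One-step extension: a value at [x0] may be prescribed as soon as it agrees
    with the values already taken on the multiples of [x0]. *)
Lemma adjoin_rel_functional x0 y0 :
  (forall a y, G (a *: x0) y -> y = a *: y0) -> functional_rel (adjoin_rel x0 y0).
Proof.
move=> h y [a]; rewrite sub0r -[- (a *: x0)]scaleNr => /h /eqP.
by rewrite scaleNr -subr_eq0 opprK subrK => /eqP.
Qed.

End Basic.

(** The graph itself is a module, and its first projection to the ring is
    injective because the relation is functional; extending the second projection
    along it gives the homomorphism defined on the whole ring. *)
Lemma injective_baer (E : lmodType R) : injective_module E -> baer E.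
Proof.
move=> hE G hG hf.
pose P : {pred R^o * E} := fun p => boolp.asbool (G p.1 p.2).
have hP : submod_closed P.
  split; first by apply/boolp.asboolP; exact: hG.1.
  move=> a [x y] [x' y'] /boolp.asboolP h /boolp.asboolP h'.
  by apply/boolp.asboolP; exact: hG.2.
pose W : lmodType R := submod_type hP.
pose v : {linear W -> (R^o * E)%type} := val.
pose f : {linear W -> R^o} := (fst \o v).
pose g : {linear W -> E} := (snd \o v).
have fi : injective f.
  move=> w w' /= e; apply/val_inj; move: (valP w) (valP w') e.
  rewrite /f /= /v /=; case: (val w) (val w') => [x y] [x' y'] /=.
  move=> /boolp.asboolP h /boolp.asboolP h' /= e; subst x'.
  by move: h h' => /= h h'; rewrite (functional_rel_uniq hG hf h h').
have [h hh] := hE _ _ f g fi.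
exists (h 1) => a e Gae.
have hp : (a, e) \in submod_pred hP by apply/boolp.asboolP.
have := hh (SubmodType hp); rewrite /f /g /v /= => <-.
by rewrite -linearZ /= /GRing.scale /= mulr1.
Qed.

End LinearRelations.

(** * Local rings with a finite filtration of simple quotients *)

Section ArtinLocal.
Variable R : comNzRingType.

Fixpoint span (xs : seq R) (y : R) : Prop :=
  if xs is x :: xs' then exists a, span xs' (y - a * x) else y = 0.

(** The ideals spanned by the tails of [xs] form a chain in which every quotient
    is killed by [mm]; for [mm] maximal it is a composition series, up to
    repetitions. *)
Fixpoint filtration (mm : R -> Prop) (xs : seq R) : Prop :=
  if xs is x :: xs' then
    (forall a, mm a -> span xs' (a * x)) /\ filtration mm xs'
  else True.

Lemma span0 xs : span xs 0.
Proof. by elim: xs => //= x xs h; exists 0; rewrite mul0r subr0. Qed.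

Lemma span_lin xs a y z : span xs y -> span xs z -> span xs (a * y + z).
Proof.
elim: xs y z => [|x xs IH] y z /=; first by move=> -> ->; rewrite mulr0 addr0.
case=> b hb [c hc]; exists (a * b + c).
have -> : a * y + z - (a * b + c) * x = a * (y - b * x) + (z - c * x) by ring.
exact: IH.
Qed.

Lemma spanM xs a y : span xs y -> span xs (a * y).
Proof. by move=> h; rewrite -[_ * _]addr0; apply: span_lin => //; apply: span0. Qed.

Lemma span_cons x xs y : span xs y -> span (x :: xs) y.
Proof. by exists 0; rewrite mul0r subr0. Qed.

Lemma span_mem (xs : seq R) x : x \in xs -> span xs x.
Proof.
elim: xs => // y xs IH; rewrite inE => /orP[/eqP ->|/IH]; last exact: span_cons.
by exists 1; rewrite mul1r subrr; exact: span0.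
Qed.

Lemma span_catl (xs ys : seq R) x : span xs x -> span (xs ++ ys) x.
Proof.
elim: xs x => [x ->|y xs IH x [a /IH h]]; first exact: span0.
by exists a.
Qed.

Lemma span_catr (xs ys : seq R) x : span ys x -> span (xs ++ ys) x.
Proof. by elim: xs => // y xs IH /IH h; exact: span_cons. Qed.

Lemma span_sub (P : R -> Prop) (xs : seq R) y : P 0 ->
  (forall a x y, P x -> P y -> P (a * x + y)) -> (forall x, x \in xs -> P x) ->
  span xs y -> P y.
Proof.
move=> P0 PL; elim: xs y => [|x xs IH] y Px; first by move=> ->.
case=> a /IH h; rewrite -(subrK (a * x) y) addrC; apply: PL; first by apply: Px; rewrite mem_head.
by apply: h => z zs; apply: Px; rewrite inE zs orbT.
Qed.

Lemma filtration_cat (mm : R -> Prop) (xs ys : seq R) : filtration mm ys ->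
  (forall x a, x \in xs -> mm a -> span ys (a * x)) -> filtration mm (xs ++ ys).
Proof.
move=> fy; elim: xs => //= x xs IH h; split.
  by move=> a ha; apply: span_catr; apply: h; rewrite ?mem_head.
by apply: IH => z a zs; apply: h; rewrite inE zs orbT.
Qed.

Lemma filtrationW (P Q : R -> Prop) xs : (forall a, Q a -> P a) ->
  filtration P xs -> filtration Q xs.
Proof. by move=> QP; elim: xs => //= x xs IH [h /IH]; split=> // a /QP /h. Qed.

(* The maximal ideal is the span of [xs] itself, so that 1 :: [xs] filters the
   whole ring. *)
Variable xs : seq R.
Local Notation mm := (span xs).
Hypothesis mm_local : forall a, mm a \/ exists b, a * b = 1.
Hypothesis mm_filtration : filtration mm xs.

Lemma unit_filtration : filtration mm (1 :: xs).
Proof. by split => // a; rewrite mulr1. Qed.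

Lemma span_unit a : span (1 :: xs) a.
Proof. by exists a; rewrite mulr1 subrr; apply: span0. Qed.

Definition socle (M : lmodType R) (z : M) : Prop := forall a, mm a -> a *: z = 0.

(** Take the first element y of the filtration 1 :: [xs], starting from the zero
    ideal, such that y x lies outside D: what multiplies y into the previous
    ideal then multiplies y x into D.  For D = 0 this finds nonzero elements of
    the socle. *)
Lemma last_outside (N : lmodType R) (D : N -> Prop) (x : N) :
  D 0 -> (forall a y z, D y -> D z -> D (a *: y + z)) -> ~ D x ->
  exists2 c, ~ D (c *: x) & forall a, mm a -> D (a *: (c *: x)).
Proof.
move=> D0 DL nDx.
suff H ys : filtration mm ys -> (forall a, span ys a -> D (a *: x)) \/
    exists2 c, ~ D (c *: x) & forall a, mm a -> D (a *: (c *: x)).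
  case: (H _ unit_filtration) => // h; case: nDx.
  by rewrite -[x]scale1r; apply/h/span_unit.
elim: ys => [_|y ys IH [fy /IH]] /=; first by left=> a ->; rewrite scale0r.
case=> [h|]; last by right.
have [Dy|nDy] := boolp.EM (D (y *: x)); last first.
  by right; exists y => // a /fy /h; rewrite scalerA.
left=> a [b /h hb]; have := DL b _ _ Dy hb.
by rewrite scalerA -scalerDl addrC subrK.
Qed.

(** An element that kills a nonzero vector is not a unit, so it lies in the
    maximal ideal. *)
Lemma socle_functional (M N : lmodType R) (s : M) (z : N) (a : R) :
  s <> 0 -> socle z -> a *: s = 0 -> a *: z = 0.
Proof.
move=> s0 hz; case: (mm_local a) => [/hz //|[b ab] as0]; case: s0.
by rewrite -[s]scale1r -ab mulrC -scalerA as0 scaler0.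
Qed.

(** For a short exact sequence 0 -> M -> E -> N -> 0 the obstruction to extending
    a homomorphism to M across a simple quotient lies in Ext^1(k, M), the cokernel
    of soc E -> soc N.  This map is onto: if s0 is a nonzero element of the socle
    of the ring, the criterion for N writes an element z of soc N as s0 w, and for
    any lift u of w the product s0 u is a lift of z that lies in soc E.
    Homomorphisms therefore extend one step of the filtration at a time. *)
Lemma baer_ext (M E N : lmodType R) (f : {linear M -> E}) (g : {linear E -> N}) :
    injective f -> (forall y, g y = 0 <-> exists x, f x = y) ->
    (forall z, exists y, g y = z) ->
  baer E -> baer N -> baer M.
Proof.
move=> fi ex gs bE bN G hG hf.
have gf x : g (f x) = 0 by apply/ex; exists x.
have [s0 s0n s0s] : exists2 s0 : R^o, s0 <> 0 & socle s0.
  have [|||c c0 h] := @last_outside R^o (fun x => x = 0) 1 => //.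
  - by move=> a y z -> ->; rewrite scaler0 addr0.
  - by apply/eqP; exact: oner_neq0.
  - by exists (c *: 1).
have lift_socle z : socle z -> exists2 s, socle s & g s = z.
  move=> hz.
  (* H is the homomorphism from the ideal of s0 to N that sends s0 to z. *)
  pose H (a : R^o) (e : N) := exists c, a = c *: s0 /\ e = c *: z.
  have hH : linear_rel H.
    split; first by exists 0; rewrite !scale0r.
    move=> a _ _ _ _ [c [-> ->]] [c' [-> ->]].
    by exists (a * c + c'); rewrite !scalerDl !scalerA.
  have [|w hw] := bN H hH.
    by move=> y [c [/esym c0 ->]]; apply: (socle_functional (s := s0)).
  have [u gu] := gs w; exists (s0 *: u).
    by move=> a /s0s h; rewrite scalerA -[a * s0]/(a *: s0) h scale0r.
  by rewrite linearZ /= gu; symmetry; apply: hw; exists 1; rewrite !scale1r.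
suff H ys : filtration mm ys -> exists G' : R^o -> M -> Prop,
    [/\ linear_rel G', functional_rel G', forall a e, G a e -> G' a e &
     forall a, span ys a -> exists e, G' a e].
  have [G' [lG' fG' sG' tG']] := H _ unit_filtration.
  have [w Gw] := tG' 1 (span_unit 1).
  exists w => a e /sG' h; apply: (functional_rel_uniq lG' fG' h).
  have := linear_relZ lG' a Gw.
  by rewrite {1}/GRing.scale /= mulr1.
elim: ys => [_|x ys IH [hx /IH [G' [lG' fG' sG' tG']]]].
  by exists G; split=> // a ->; exists 0; exact: hG.1.
suff [G'' [lG'' fG'' sG'' [e0 he0]]] : exists G'' : R^o -> M -> Prop,
    [/\ linear_rel G'', functional_rel G'', forall a e, G' a e -> G'' a e &
     exists e, G'' x e].
  exists G''; split=> // [a e /sG' /sG'' //|a [c /tG' [e /sG'' he]]].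
  exists (c *: e0 + e); have := lG''.2 c _ _ _ _ he0 he.
  by rewrite [X in G'' X]addrC subrK.
have [?|nx] := boolp.EM (exists e, G' x e); first by exists G'.
(* As a map to E the homomorphism G' is multiplication by some y0, so its value
   at x should be x y0; this lies in M only after a correction s from soc E. *)
pose H (a : R^o) (e : E) := exists2 v, G' a v & e = f v.
have hH : linear_rel H.
  split; first by exists 0; [exact: lG'.1 | rewrite linear0].
  move=> a z _ z' _ [v h ->] [v' h' ->]; exists (a *: v + v'); first exact: lG'.2.
  by rewrite linearP.
have [|y0 hy0] := bE H hH.
  by move=> _ [v /fG' -> ->]; rewrite linear0.
have hz : socle (x *: g y0).
  move=> a /hx /tG' [e he]; rewrite scalerA -linearZ /=.
  by rewrite -(hy0 (a * x) (f e)) ?gf //; exists e.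
have [s ss gs0] := lift_socle _ hz.
have [v hv] : exists v, f v = x *: y0 - s.
  by apply/ex; rewrite linearB linearZ /= gs0 subrr.
exists (adjoin_rel G' (x : R^o) v); split.
- exact: adjoin_rel_linear.
- apply: adjoin_rel_functional => c e he; apply: fi.
  have -> : f e = (c * x) *: y0 by apply: hy0; exists e.
  rewrite linearZ /= hv scalerBr scalerA.
  suff -> : c *: s = 0 by rewrite subr0.
  case: (mm_local c) => [/ss //|[b cb]]; case: nx.
  exists (b *: e); have := linear_relZ lG' b he.
  by rewrite scalerA [b * c]mulrC cb scale1r.
- by move=> a e; exact: adjoin_relW.
- by exists v; exact: adjoin_rel_new.
Qed.

Lemma injective_dim_baer n (M : lmodType R) : injective_dim_le n M -> baer M.
Proof.
elim=> {n M} [M /injective_baer //|n M E N f g /injective_baer bE fi ex gs _ bN].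
exact: baer_ext fi ex gs bE bN.
Qed.

(** The map between the simple ideals of s and t that sends s to t extends to the
    whole ring, that is, to a multiplication. *)
Lemma gorenstein_socle (s t : R^o) :
  gorenstein_local R -> socle s -> socle t -> s <> 0 -> exists c, t = c * s.
Proof.
case=> n /injective_dim_baer bR ss st s0.
pose G (a e : R^o) := exists c, a = c *: s /\ e = c *: t.
have hG : linear_rel G.
  split; first by exists 0; rewrite !scale0r.
  move=> a _ _ _ _ [c [-> ->]] [c' [-> ->]].
  by exists (a * c + c'); rewrite !scalerDl !scalerA.
have [|w hw] := bR G hG.
  by move=> y [c [/esym c0 ->]]; apply: (socle_functional (s := s)).
exists w; rewrite mulrC; apply: hw.
by exists 1; rewrite !scale1r.
Qed.

Section SimpleSocle.
Hypothesis socle_simple :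
  forall s t : R^o, socle s -> socle t -> s <> 0 -> exists c, t = c * s.

(** With V = span ys and V' = span (y :: ys): if ann V kills y there is nothing to
    do, as then ann V = ann V'.  Otherwise some u0 in ann V sends y to a generator
    of the socle.  If x is killed by ann V', then u0 x is in the socle too, say
    u0 x = c u0 y; now x - c y is killed by u0 and by ann V', which span ann V, so
    it lies in V by induction. *)
Lemma double_annihilator ys x : filtration mm ys ->
  (forall u, (forall v, span ys v -> u * v = 0) -> u * x = 0) -> span ys x.
Proof.
elim: ys x => [|y ys IH] x /=.
  by move=> _ /(_ 1); rewrite mul1r; apply=> v ->; rewrite mulr0.
move=> [hy /IH {}IH] hx.
pose ann u := forall v, span ys v -> u * v = 0.
have annS u : ann u -> u * y = 0 -> u * x = 0.
  move=> hu uy; apply: hx => v [a /hu].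
  by rewrite mulrBr mulrCA uy mulr0 subr0.
have annM a u : ann u -> ann (a * u).
  by move=> hu v /hu; rewrite -mulrA => ->; rewrite mulr0.
have [[u0 [hu0 u0y]]|no] := boolp.EM (exists u, ann u /\ u * y <> 0); last first.
  apply: span_cons; apply: IH => u hu; apply: annS => //.
  by apply: boolp.contrapT => h; apply: no; exists u.
have soc_y u : ann u -> socle (u * y : R^o).
  by move=> hu a /hy /hu; rewrite /GRing.scale /= mulrCA.
have soc_x : socle (u0 * x : R^o).
  move=> a ha; rewrite /GRing.scale /= mulrA; apply: annS; first exact: annM.
  by rewrite -mulrA; exact: soc_y.
have [c hc] := socle_simple (soc_y _ hu0) soc_x u0y.
exists c; apply: IH => u hu.
have [c1 hc1] := socle_simple (soc_y _ hu0) (soc_y _ hu) u0y.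
have /annS : ann (u - c1 * u0).
  by move=> v hv; rewrite mulrBl -mulrA hu // hu0 // mulr0 subr0.
move=> h; have : (u - c1 * u0) * x = 0 by apply: h; rewrite mulrBl hc1 -mulrA subrr.
move/eqP; rewrite mulrBl -mulrA hc subr_eq0 => /eqP ux.
by rewrite mulrBr ux [u * (c * y)]mulrCA hc1; ring.
Qed.

(** Inductively the homomorphism is multiplication by some v0 on span ys.  On the
    next generator y the error e - y v0 lies in the socle, and the double
    annihilator property provides an element that kills span ys but not y; a
    multiple of it corrects v0. *)
Lemma hom_span_mul (G : R^o -> R^o -> Prop) ys : linear_rel G -> functional_rel G ->
  filtration mm ys -> (forall a, span ys a -> exists e, G a e) ->
  exists v, forall a, span ys a -> G a (a * v).
Proof.
move=> lG fG; elim: ys => [_ _|y ys IH [hy fys] tG].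
  by exists 0 => a ->; rewrite mulr0; exact: lG.1.
have [|v0 hv0] := IH fys; first by move=> a /(span_cons y); exact: tG.
have [yin|yout] := boolp.EM (span ys y).
  exists v0 => a [b /(span_lin b yin)]; rewrite addrC subrK; exact: hv0.
have [e he] : exists e, G y e.
  by apply: tG; exists 1; rewrite mul1r subrr; exact: span0.
have soc_t : socle (e - y * v0 : R^o).
  move=> a /hy /hv0 h.
  have k := functional_rel_uniq lG fG (linear_relZ lG a he) h.
  by rewrite scalerBr k /GRing.scale /= mulrA subrr.
have [u [hu uy]] : exists u, (forall v, span ys v -> u * v = 0) /\ u * y <> 0.
  apply: boolp.contrapT => no; apply: yout; apply: double_annihilator => // u hu.
  by apply: boolp.contrapT => h; apply: no; exists u.
have soc_uy : socle (u * y : R^o).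
  by move=> a /hy /hu; rewrite /GRing.scale /= mulrCA.
have [c hc] := socle_simple soc_uy soc_t uy.
exists (v0 + c * u) => a [b hb].
have -> : a * (v0 + c * u) = b * e + (a - b * y) * v0.
  have ab : u * a = u * (b * y) by apply/eqP; rewrite -subr_eq0 -mulrBr hu.
  have -> : e = y * v0 + c * (u * y) by rewrite -hc addrC subrK.
  rewrite mulrDr; have -> : a * (c * u) = c * (u * a) by ring.
  by rewrite ab; ring.
have := lG.2 b _ _ _ _ he (hv0 _ hb).
by rewrite [X in G X]addrC subrK.
Qed.

(** A maximal partial extension of g is defined everywhere: otherwise
    [last_outside] gives x' outside its domain such that mm x' lies inside; the
    resulting homomorphism from mm to the ring is multiplication by some v
    by [hom_span_mul], and x' may be sent to v. *)
Lemma socle_simple_injective : injective_module (R^o : lmodType R).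
Proof.
move=> M N f g fi.
pose good (G : N -> R^o -> Prop) := linear_rel G /\ functional_rel G.
(* Zorn is applied to the sets X whose union with the graph G0 of g is good, so
   that the empty chain needs no special care. *)
pose G0 (n : N) (e : R^o) := exists x, n = f x /\ e = g x.
have good0 : good G0.
  split; first split.
  - by exists 0; rewrite !linear0.
  - move=> a _ _ _ _ [x [-> ->]] [x' [-> ->]].
    by exists (a *: x + x'); rewrite !linearP.
  - by move=> _ [x [/esym h ->]]; rewrite (fi x 0) ?linear0 ?h.
pose U (X : N * R^o -> Prop) n e := X (n, e) \/ G0 n e.
have [F sF tF|X [gX mX]] :=
    @classical_sets.Zorn_bigcup (N * R^o)%type (fun X => good (U X)).
  set B := classical_sets.bigcup _ _.
  have BP p : B p <-> exists2 X, F X & X p by split=> [[X]|[X]]; exists X.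
  have UB n e : U B n e -> G0 n e \/ exists2 X, F X & U X n e.
    by case=> [/BP [X FX h]|]; [right; exists X => //; left|left].
  have BU X : F X -> forall n e, U X n e -> U B n e.
    by move=> FX n e [h|]; [left; apply/BP; exists X|right].
  have F2 n e n' e' : U B n e -> U B n' e' -> (G0 n e /\ G0 n' e') \/
      exists2 X, F X & U X n e /\ U X n' e'.
    move=> /UB [h|[X FX h]] /UB [h'|[X' FX' h']]; first by left.
    - by right; exists X' => //; split => //; right.
    - by right; exists X => //; split => //; right.
    - right; case: (tF _ _ FX FX') => sub.
        exists X' => //; split=> //; case: h => h; last by right.
        by left; apply: sub.
      exists X => //; split=> //; case: h' => h'; last by right.
      by left; apply: sub.
  split; first split.
  - by right; exact: good0.1.1.
  - move=> a x y x' y' h h'; case: (F2 _ _ _ _ h h') => [[k k']|[X FX [k k']]].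
      by right; apply: good0.1.2.
    by apply: (BU X FX); apply: (sF X FX).1.2.
  - move=> y /UB [|[X FX]]; first exact: good0.2.
    exact: (sF X FX).2.
have [lG fG] := gX.
have dom x : exists e, U X x e.
  apply: boolp.contrapT => nx.
  have [||c nc hc] := last_outside (D := fun x => exists e, U X x e) _ _ nx.
  - by exists 0; exact: lG.1.
  - by move=> a y z [e he] [e' he']; exists (a *: e + e'); exact: lG.2.
  set x' := c *: x in nc hc.
  pose H (a e : R^o) := U X (a *: x') e.
  have lH : linear_rel H.
    split; first by rewrite /H scale0r; exact: lG.1.
    by move=> a y e y' e' h h'; rewrite /H scalerDl -scalerA; exact: lG.2.
  have fH : functional_rel H by move=> e; rewrite /H scale0r; exact: fG.
  have [v hv] := hom_span_mul lH fH mm_filtration hc.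
  have gG' : good (adjoin_rel (U X) x' v).
    split; first exact: adjoin_rel_linear.
    apply: adjoin_rel_functional => a e h.
    case: (mm_local a) => [/hv h'|[b ab]].
      by rewrite (functional_rel_uniq lG fG h h').
    case: nc; exists (b *: e); have := linear_relZ lG b h.
    by rewrite scalerA mulrC ab scale1r.
  apply: (mX (fun p => adjoin_rel (U X) x' v p.1 p.2)); last first.
    rewrite /U /=; set Z := (fun n e => _ \/ _).
    suff -> : Z = adjoin_rel (U X) x' v by [].
    apply: boolp.funext => n; apply: boolp.funext => e; apply: boolp.propext.
    by split=> [[//|h]|]; [apply: adjoin_relW; right|left].
  split=> [[n e] h|sub]; first by apply: adjoin_relW; left.
  apply: nc; exists v; left; apply: sub => /=; exact: adjoin_rel_new.
pose h n := projT1 (boolp.cid (dom n)).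
have hP n : U X n (h n) := projT2 (boolp.cid (dom n)).
have hL : linear h.
  move=> a y z; apply: (functional_rel_uniq lG fG (hP _)).
  exact: lG.2.
pose hh : {linear N -> R^o} := HB.pack h (GRing.isLinear.Build R N R^o _ h hL).
exists hh => x; apply: (functional_rel_uniq lG fG (hP _)).
by right; exists x.
Qed.

End SimpleSocle.

Lemma gorensteinP : gorenstein_local R <->
  (forall s t : R^o, socle s -> socle t -> s <> 0 -> exists c, t = c * s).
Proof.
split=> [h s t|h]; first exact: gorenstein_socle.
by exists 0%N; apply/InjectiveDim0/socle_simple_injective.
Qed.

End ArtinLocal.

(** * Polynomial vectors modulo an initial set of variables *)

Section InitialVariables.
Variables (K : fieldType) (n : nat).
Local Notation S := {mpoly K[n]}.

Definition free_of (j : nat) (m : 'X_{1..n}) : Prop :=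
  forall i : 'I_n, (i < j)%N -> m i = 0%N.

(** Membership in the ideal generated by the variables of index less than [j]:
    being a monomial ideal, it can be read off the coefficients. *)
Definition in_vars (j : nat) (p : S) : Prop :=
  forall m, free_of j m -> p@_m = 0.

Definition in_varsv (j k : nat) (v : 'cV[S]_k) : Prop :=
  forall a, in_vars j (v a 0).

Lemma in_vars0 j : in_vars j 0.
Proof. by move=> m _; rewrite mcoeff0. Qed.

Lemma in_varsD j p q : in_vars j p -> in_vars j q -> in_vars j (p + q).
Proof. by move=> hp hq m hm; rewrite mcoeffD hp // hq // addr0. Qed.

Lemma in_varsM j p q : in_vars j q -> in_vars j (p * q).
Proof.
move=> hq m hm; rewrite mcoeffM big1 // => k /eqP mE.
rewrite [q@__]hq ?mulr0 // => i ij.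
have := congr1 (fun m' : 'X_{1..n} => m' i) mE.
by rewrite hm // mnmDE => /esym/eqP; rewrite addn_eq0 => /andP[_ /eqP].
Qed.

Lemma in_vars_eq0 p : in_vars 0 p -> p = 0.
Proof. by move=> h; apply/mpolyP => m; rewrite mcoeff0; apply: h. Qed.

Lemma in_vars_X j (i : 'I_n) p : (i < j)%N -> in_vars j ('X_i * p).
Proof.
move=> ij; rewrite mulrC; apply: in_varsM => m hm; rewrite mcoeffX.
by case: eqP => // mE; have := hm i ij; rewrite -mE mnm1E eqxx.
Qed.

Lemma in_vars_regular j (i : 'I_n) p :
  (j <= i)%N -> in_vars j ('X_i * p) -> in_vars j p.
Proof.
move=> ji h m hm; have := h (m + U_(i))%MM.
rewrite mulrC addmC mcoeffMX; apply=> k kj.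
rewrite mnmDE mnm1E hm // addn0; case: eqP => // ik; move: kj ji; rewrite ik; lia.
Qed.

Lemma in_vars_const p : in_vars n p <-> p@_0%MM = 0.
Proof.
split=> [h|h m hm]; first by apply: h => i _; rewrite mnm0E.
suff -> : m = 0%MM by [].
by apply/mnmP => i; rewrite mnm0E hm.
Qed.

Lemma div_var (i : 'I_n) (p : S) : exists q : S, forall m, q@_m = p@_(m + U_(i)).
Proof.
elim/mpolyind: p => [|c m p _ _ [q hq]]; first by exists 0 => m; rewrite !mcoeff0.
case: (posnP (m i)) => mi.
  exists q => m'; rewrite mcoeffD mcoeffZ mcoeffX hq; case: eqP => [E|]; last first.
    by rewrite mulr0 add0r.
  by have := mi; rewrite E mnmDE mnm1E eqxx addn1.
exists (c *: 'X_[m - U_(i)] + q) => m'.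
rewrite !mcoeffD !mcoeffZ !mcoeffX hq; congr (_ * _%:R + _).
have um : (U_(i) <= m)%MM by apply/mnm_lepP => k; rewrite mnm1E; case: eqP => // <-.
by rewrite -[in RHS](submK um) (inj_eq (@addIm _ _)).
Qed.

Lemma in_vars_split (i : 'I_n) p : in_vars i.+1 p ->
  exists q, in_vars i (p - 'X_i * q).
Proof.
move=> hp; have [q hq] := div_var i p; exists q => m hm.
rewrite mcoeffB mulrC; case: (posnP (m i)) => mi.
  rewrite hp ?sub0r; last first.
    by move=> k; rewrite ltnS leq_eqVlt => /orP[/eqP/ord_inj ->|/hm].
  apply/eqP; rewrite oppr_eq0; apply/eqP/memN_msupp_eq0.
  rewrite (perm_mem (msuppMX _ _)); apply/mapP => -[k _ E].
  by move: mi; rewrite E mnmDE mnm1E eqxx.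
have um : (U_(i) <= m)%MM by apply/mnm_lepP => k; rewrite mnm1E; case: eqP => // <-.
by rewrite -[m in X in _ - X](submK um) addmC mcoeffMX hq submK // subrr.
Qed.

Section Vectors.
Variable k : nat.
Implicit Types v w : 'cV[S]_k.

Lemma in_varsv0 j : in_varsv j (0 : 'cV[S]_k).
Proof. by move=> a; rewrite mxE; exact: in_vars0. Qed.

Lemma in_varsvD j v w : in_varsv j v -> in_varsv j w -> in_varsv j (v + w).
Proof. by move=> hv hw a; rewrite mxE; apply: in_varsD. Qed.

Lemma in_varsvZ j p v : in_varsv j v -> in_varsv j (p *: v).
Proof. by move=> hv a; rewrite mxE; apply: in_varsM. Qed.

Lemma in_varsv_mul j l (A : 'M[S]_(l, k)) v : in_varsv j v -> in_varsv j (A *m v).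
Proof.
move=> hv a; rewrite mxE; apply: (big_ind (in_vars _)); [exact: in_vars0|exact: in_varsD|].
by move=> b _; apply: in_varsM.
Qed.

Lemma in_varsv_eq0 v : in_varsv 0 v <-> v = 0.
Proof.
split=> [h|->]; last exact: in_varsv0.
by apply/matrixP => a b; rewrite ord1 mxE; apply/in_vars_eq0/h.
Qed.

Lemma in_varsv_X j (i : 'I_n) v : (i < j)%N -> in_varsv j ('X_i *: v).
Proof. by move=> ij a; rewrite mxE; apply: in_vars_X. Qed.

Lemma in_varsv_regular j (i : 'I_n) v :
  (j <= i)%N -> in_varsv j ('X_i *: v) -> in_varsv j v.
Proof. by move=> ji h a; have := h a; rewrite mxE; apply: in_vars_regular. Qed.

Lemma in_varsv_split (i : 'I_n) v : in_varsv i.+1 v ->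
  exists w, in_varsv i (v - 'X_i *: w).
Proof.
move=> hv; pose q a := projT1 (boolp.cid (in_vars_split (hv a))).
exists (\col_a q a) => a; rewrite !mxE.
exact: (projT2 (boolp.cid (in_vars_split (hv a)))).
Qed.

Lemma in_varsv_join (i : 'I_n) v w : in_varsv i (v - 'X_i *: w) -> in_varsv i.+1 v.
Proof.
move=> h; rewrite -(subrK ('X_i *: w) v); apply: in_varsvD; last exact: in_varsv_X.
by move=> a m hm; apply: h => l li; apply: hm; rewrite ltnS ltnW.
Qed.

Lemma in_varsv_trans j v w u :
  in_varsv j (v - w) -> in_varsv j (w - u) -> in_varsv j (v - u).
Proof. by move=> h h'; have := in_varsvD h h'; rewrite addrA subrK. Qed.

Lemma in_varsv_sym j v w : in_varsv j (v - w) -> in_varsv j (w - v).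
Proof. by move/(in_varsvZ (-1)); rewrite scaleN1r opprB. Qed.

End Vectors.
End InitialVariables.

(** * The socle and the last module of the resolution *)

Section Socle.
Variables (K : fieldType) (n : nat).
Local Notation S := {mpoly K[n]}.
Variables (f : nat -> nat) (phi : forall i, 'M[S]_(f i, f i.+1)).
Hypothesis phi_exact : forall i (v : 'cV[S]_(f i.+1)),
  phi i *m v = 0 <-> exists w, v = phi i.+1 *m w.
Hypothesis phi_minimal : forall i, minimal_map (phi i).

Lemma phi_phi i (w : 'cV[S]_(f i.+2)) : phi i *m (phi i.+1 *m w) = 0.
Proof. by apply/phi_exact; exists w. Qed.

(** With A the cokernel of phi 0, this is the vanishing of
    Tor_k (A, S/(x_0, ..., x_(j-1))) for k > j.  The step from j to j + 1, where all
    equations are modulo the first j variables: if phi w = x_j u, then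
    x_j phi u = 0, hence phi u = 0 as x_j is regular; by exactness u = phi v, and
    w - x_j v is a cycle. *)
Lemma exact_mod_vars j k (w : 'cV[S]_(f k.+1)) : (j <= k)%N -> (j <= n)%N ->
  in_varsv j (phi k *m w) -> exists v, in_varsv j (w - phi k.+1 *m v).
Proof.
elim: j k w => [|j IH] k w jk jn.
  move=> /in_varsv_eq0 /phi_exact [v ->]; exists v.
  by apply/in_varsv_eq0; rewrite subrr.
case: k w jk => // k w jk.
pose i := Ordinal jn => /(@in_varsv_split _ _ _ i) [u hu].
have /IH : in_varsv j (phi k *m u).
  apply: (in_varsv_regular (i := i)) => //.
  have := in_varsv_mul (phi k) hu.
  rewrite mulmxBr phi_phi sub0r -scaleN1r => /(in_varsvZ (-1)).
  by rewrite scalerA mulN1r opprK scale1r -scalemxAr.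
case; rewrite ?(ltnW jn) // => v hv.
have [] := IH k.+1 (w - 'X_i *: v) (ltnW jk) (ltnW jn).
  rewrite mulmxBr -scalemxAr; apply: in_varsv_trans hu _.
  by rewrite -scalerBr; apply: in_varsvZ.
move=> v' hv'; exists v'; apply: (in_varsv_join (i := i) (w := v)).
by rewrite addrAC.
Qed.

(** The socles of the modules coker (phi k) / (x_0, ..., x_(k-1)) interpolate
    between the socle of coker (phi 0) and, for k = n, the last module modulo all
    variables. *)
Definition socle_mod k (w : 'cV[S]_(f k)) : Prop :=
  forall i : 'I_n, exists v, in_varsv k ('X_i *: w - phi k *m v).

Definition zero_mod k (w : 'cV[S]_(f k)) : Prop :=
  exists v, in_varsv k (w - phi k *m v).

(** A connecting homomorphism, as a relation: for w in the socle, x_i w is a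
    boundary modulo the first i variables, and w' is what it bounds. *)
Definition linked (i : 'I_n) (w : 'cV[S]_(f i)) (w' : 'cV[S]_(f i.+1)) : Prop :=
  in_varsv i ('X_i *: w - phi i *m w').

Lemma linked_next (i : 'I_n) w : socle_mod w -> exists w', linked (i := i) w w'.
Proof. by move=> /(_ i). Qed.

(** If x_k w = phi v, then phi (x_k w' - x_i v) = x_k x_i w - x_i x_k w = 0 modulo
    the first i variables, and [exact_mod_vars] applies. *)
Lemma linked_socle (i : 'I_n) w w' :
  linked (i := i) w w' -> socle_mod w -> socle_mod w'.
Proof.
move=> hl hw k; have [v hv] := hw k.
have [|||u hu] := exact_mod_vars (j := i) (k := i) (w := 'X_k *: w' - 'X_i *: v).
- by [].
- exact: ltnW.
- rewrite mulmxBr -!scalemxAr.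
  apply: (in_varsv_trans (w := 'X_k *: ('X_i *: w))).
    by rewrite -scalerBr; apply/in_varsvZ/in_varsv_sym.
  by rewrite scalerA mulrC -scalerA -scalerBr; apply/in_varsvZ.
by exists u; apply: (in_varsv_join (i := i) (w := v)); rewrite addrAC.
Qed.

Lemma linked_zero (i : 'I_n) w w' : linked (i := i) w w' -> zero_mod w <-> zero_mod w'.
Proof.
move=> hl; split=> [[u hu]|[v /(@in_varsv_split _ _ _ i) [u hu]]].
  have [|||v hv] := exact_mod_vars (j := i) (k := i) (w := w' - 'X_i *: u).
  - by [].
  - exact: ltnW.
  - rewrite mulmxBr -scalemxAr.
    apply: (in_varsv_trans (w := 'X_i *: w)); first exact: in_varsv_sym.
    by rewrite -scalerBr; apply: in_varsvZ.
  by exists v; apply: (in_varsv_join (i := i) (w := u)); rewrite addrAC.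
exists u; apply: (in_varsv_regular (i := i)) => //.
rewrite scalerBr; apply: in_varsv_trans hl _.
have := in_varsv_mul (phi i) hu.
by rewrite !mulmxBr phi_phi subr0 -scalemxAr.
Qed.

Lemma linked_prev_socle (i : 'I_n) w w' :
  linked (i := i) w w' -> socle_mod w' -> socle_mod w.
Proof.
move=> hl hw' k; have [v /(@in_varsv_split _ _ _ i) [u hu]] := hw' k.
exists u; apply: (in_varsv_regular (i := i)) => //.
rewrite scalerBr; apply: (in_varsv_trans (w := 'X_k *: (phi i *m w'))).
  by rewrite scalerA mulrC -scalerA -scalerBr; apply: in_varsvZ.
have := in_varsv_mul (phi i) hu.
by rewrite !mulmxBr phi_phi subr0 -!scalemxAr.
Qed.

(** It has to be shown that phi w' vanishes modulo the variables up to x_i.  If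
    there is a further variable x_k, then x_k w' is a boundary modulo those
    variables, so x_k phi w' vanishes and x_k is regular.  For the last variable
    it is the minimality of the resolution. *)
Lemma linked_prev (i : 'I_n) w' : socle_mod w' -> exists w, linked (i := i) w w'.
Proof.
move=> hw'.
suff /in_varsv_split [w hw] : in_varsv i.+1 (phi i *m w').
  by exists w; apply: in_varsv_sym.
have [lt|ge] := ltnP i.+1 n; last first.
  have iE : i.+1 = n by apply/eqP; rewrite eqn_leq ltn_ord.
  move=> a; rewrite mxE; apply: (big_ind (in_vars _)); [exact: in_vars0|exact: in_varsD|].
  move=> b _; rewrite mulrC; apply: in_varsM; rewrite [j in in_vars j _]iE.
  by apply/in_vars_const; exact: phi_minimal.
pose k := Ordinal lt.
have [v hv] := hw' k.
apply: (in_varsv_regular (i := k)) => //.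
have := in_varsv_mul (phi i) hv.
by rewrite mulmxBr phi_phi subr0 -scalemxAr.
Qed.

(** The relation is the composite of the links with indices less than [k].  It is
    linear over S, and it induces a bijection between the two socles: it is total
    and onto there, and zero classes correspond to zero classes. *)
Lemma socle_transfer k : (k <= n)%N ->
  exists L : 'cV[S]_(f 0) -> 'cV[S]_(f k) -> Prop,
  [/\ forall p s w s' w', L s w -> L s' w' -> L (p *: s + s') (p *: w + w'),
      forall s, socle_mod s -> exists w, L s w,
      forall s w, L s w -> (zero_mod s <-> zero_mod w),
      forall s w, L s w -> (socle_mod s <-> socle_mod w)
    & forall w, socle_mod w -> exists s, L s w].
Proof.
elim: k => [_|k IH kn].
  by exists eq; split=> [p s w s' w' -> -> //|s _|s _ <-|s _ <-|w _] //; [exists s|exists w].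
have [L [Ladd Lnext Lzero Lsocle Lprev]] := IH (ltnW kn).
pose i := Ordinal kn.
exists (fun s w' => exists2 w, L s w & linked (i := i) w w'); split.
- move=> p s w s' w' [v h l] [v' h' l']; exists (p *: v + v'); first exact: Ladd.
  rewrite /linked scalerDr mulmxDr -scalemxAr scalerA mulrC -scalerA opprD addrACA.
  by rewrite -scalerBr; apply/in_varsvD/l'/in_varsvZ/l.
- move=> s hs; have [w h] := Lnext s hs.
  have /(linked_next (i := i)) [w' h'] : socle_mod w by apply/(Lsocle _ _ h).
  by exists w', w.
- by move=> s w' [w /Lzero h /linked_zero h']; apply: iff_trans h h'.
- move=> s w' [w /Lsocle h l]; apply: (iff_trans h).
  by split; [exact: linked_socle l|exact: linked_prev_socle l].
- move=> w' hw'; have [w l] := linked_prev (i := i) hw'.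
  have [s h] := Lprev w (linked_prev_socle l hw').
  by exists s, w.
Qed.

(** At the end of the chain all variables have been divided out: every vector is
    in the socle, and its class is its vector of constant coefficients. *)
Theorem socle_correspondence :
  exists L : 'cV[S]_(f 0) -> 'cV[S]_(f n) -> Prop,
  [/\ forall p s w s' w', L s w -> L s' w' -> L (p *: s + s') (p *: w + w'),
      forall s, (forall i : 'I_n, exists v, 'X_i *: s = phi 0%N *m v) ->
        exists w, L s w,
      forall s w, L s w ->
        ((exists v, s = phi 0%N *m v) <-> forall a, (w a 0)@_(0%MM) = 0)
    & forall w, exists2 s, L s w &
        forall i : 'I_n, exists v, 'X_i *: s = phi 0%N *m v].
Proof.
have [L [Ladd Lnext Lzero Lsocle Lprev]] := socle_transfer (leqnn n).
have socle0 s : socle_mod (k := 0) s <->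
    forall i : 'I_n, exists v, 'X_i *: s = phi 0%N *m v.
  split=> h i; have [v hv] := h i; exists v.
    by move/in_varsv_eq0/eqP: hv; rewrite subr_eq0 => /eqP.
  by apply/in_varsv_eq0; rewrite hv subrr.
have soclen w : socle_mod (k := n) w.
  by move=> i; exists 0; rewrite mulmx0 subr0; apply: in_varsv_X.
exists L; split=> //.
- by move=> s /socle0 /Lnext.
- move=> s w /Lzero h; split=> [[v sv] a|hw].
    have /h [u hu] : zero_mod s by exists v; rewrite sv subrr; apply: in_varsv0.
    have /in_vars_const := hu a.
    rewrite [fun_of_matrix _ a 0]mxE [X in _ + X]mxE mcoeffB => /eqP.
    rewrite subr_eq0 => /eqP ->.
    suff : in_vars n ((phi n *m u) a 0) by move/in_vars_const.
    rewrite mxE; apply: (big_ind (in_vars _)); [exact: in_vars0|exact: in_varsD|].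
    by move=> b _; rewrite mulrC; apply: in_varsM; apply/in_vars_const/phi_minimal.
  have /h [v /in_varsv_eq0/eqP] : zero_mod w.
    by exists 0; rewrite mulmx0 subr0 => a; apply/in_vars_const.
  by rewrite subr_eq0 => /eqP ?; exists v.
- move=> w; have [s h] := Lprev w (soclen w); exists s => //.
  by apply/socle0/(Lsocle _ _ h).
Qed.

End Socle.

(** * Dimension count in a fixed degree *)

Section EulerCharacteristic.
Variables (K : fieldType) (V : nat -> vectType K).
Variable f : forall i, 'Hom(V i.+1, V i).
Hypothesis f_exact : forall i, lker (f i) = limg (f i.+1).
Hypothesis f_surj : limg (f 0) = fullv.

Lemma euler_partial k :
  \sum_(i < k.+1) (-1) ^+ i * (dim (V i))%:R =
    (-1) ^+ k * (\dim (limg (f k)))%:R :> rat.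
Proof.
elim: k => [|k IH]; first by rewrite big_ord1 f_surj dimvf.
rewrite big_ord_recr /= IH -dimvf -(limg_ker_dim (f k) fullv) capfv f_exact.
rewrite natrD exprS; ring.
Qed.

Lemma euler_eq0 k : dim (V k.+1) = 0%N ->
  \sum_(i < k.+1) (-1) ^+ i * (dim (V i))%:R = 0 :> rat.
Proof.
move=> h; rewrite euler_partial.
have := limg_ker_dim (f k) fullv; rewrite dimvf h => /eqP.
by rewrite addn_eq0 => /andP[_ /eqP ->]; rewrite mulr0.
Qed.
End EulerCharacteristic.

Section GradedPieces.
Variables (K : fieldType) (n : nat).
Local Notation S := {mpoly K[n]}.

(** The monomial basis of the degree [t] part of the free module with twists [a];
    monomials are bounded by [t] in degree only to have a finite type. *)
Definition piece_basis (a : seq nat) (t : nat) : finType :=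
  {x : 'I_(size a) * 'X_{1..n < t.+1} | (nth 0%N a x.1 + mdeg x.2 == t)%N}.

Section OneModule.
Variables (a : seq nat) (t : nat).
Local Notation T := (piece_basis a t).
Implicit Types (v w : 'cV[S]_(size a)) (u : {ffun T -> K^o}).

Definition coords v : {ffun T -> K^o} := [ffun x : T => (v (val x).1 0)@_(val x).2].

Definition of_coords u : 'cV[S]_(size a) :=
  \col_j \sum_(x : T | (val x).1 == j) u x *: 'X_[(val x).2].

Definition homogv v : Prop :=
  forall (j : 'I_(size a)) m, (nth 0%N a j + mdeg m)%N <> t -> (v j 0)@_m = 0.

Lemma of_coords_in u (x : T) : (of_coords u (val x).1 0)@_(val x).2 = u x.
Proof.
rewrite mxE raddf_sum (bigD1 x) //= mcoeffZ mcoeffX eqxx mulr1 big1 ?addr0 //.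
move=> y /andP[/eqP y1 yx]; rewrite mcoeffZ mcoeffX; case: eqP; last by rewrite mulr0.
move=> y2; case/eqP: yx; apply/val_inj.
by rewrite [LHS]surjective_pairing [RHS]surjective_pairing y1; congr pair; apply/val_inj.
Qed.

Lemma of_coords_homog u : homogv (of_coords u).
Proof.
move=> j m h; rewrite mxE raddf_sum big1 //= => x /eqP xj.
rewrite mcoeffZ mcoeffX; case: eqP; last by rewrite mulr0.
by move=> xm; case: h; rewrite -xj -xm; apply/eqP; exact: (valP x).
Qed.

Lemma coords_in (j : 'I_(size a)) m : (nth 0%N a j + mdeg m)%N = t ->
  exists x : T, forall v, (v j 0)@_m = coords v x.
Proof.
move=> h; have mt : (mdeg m < t.+1)%N by lia.
have hx : (nth 0%N a (j, BMultinom mt).1 + mdeg (j, BMultinom mt).2 == t)%N by apply/eqP.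
exists (Sub (j, BMultinom mt) hx : T); by move=> v; rewrite ffunE SubK.
Qed.

Lemma of_coordsK u : coords (of_coords u) = u.
Proof. by apply/ffunP => x; rewrite ffunE of_coords_in. Qed.

Lemma coordsK v : homogv v -> of_coords (coords v) = v.
Proof.
move=> hv; apply/matrixP => j k; rewrite ord1; apply/mpolyP => m.
have [h|/eqP h] := eqVneq (nth 0%N a j + mdeg m)%N t; last first.
  by rewrite hv // of_coords_homog.
have [x hx] := coords_in h.
by rewrite !hx of_coordsK.
Qed.

Lemma coords_lin (c : K) v w : coords (c%:MP *: v + w) = c *: coords v + coords w.
Proof. by apply/ffunP => x; rewrite !ffunE !mxE mcoeffD mcoeffCM. Qed.

Lemma of_coords_lin (c : K) u u' :
  of_coords (c *: u + u') = c%:MP *: of_coords u + of_coords u'.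
Proof.
apply/matrixP => j k; rewrite !mxE mulr_sumr -big_split /=.
apply: eq_bigr => x _; rewrite !ffunE scalerDl mul_mpolyC scalerA.
by [].
Qed.

End OneModule.

Lemma card_piece_basis0 t : #|piece_basis [::] t| = 0%N.
Proof. by rewrite card_sig; apply: eq_card0 => -[[]]. Qed.

Section OneMap.
Variables (a c : seq nat) (phi : 'M[S]_(size a, size c)) (t : nat).
Hypothesis phi_graded : graded_map phi.

Lemma graded_map_coef0 (v : 'cV[S]_(size c)) (k : 'I_(size a)) m :
  (forall (j : 'I_(size c)) m', (nth 0%N c j + mdeg m' = nth 0%N a k + mdeg m)%N -> (v j 0)@_m' = 0) ->
  ((phi *m v) k 0)@_m = 0.
Proof.
move=> h; rewrite mxE raddf_sum big1 //= => j _; rewrite mcoeffM big1 // => l /eqP ml.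
have [hl|/memN_msupp_eq0 ->] := boolP ((l.1 : 'X_{1..n}) \in msupp (phi k j)); last first.
  by rewrite mul0r.
by rewrite h ?mulr0 // -(phi_graded hl) -addnA -mdegD -ml.
Qed.

Lemma graded_map_homog v : homogv t v -> homogv t (phi *m v).
Proof.
move=> hv k m hm; apply: graded_map_coef0 => j m' E; apply: hv.
by rewrite E.
Qed.

(** A graded map sends the part of [v] outside degree [t] to vectors without any
    component of degree [t]. *)
Lemma graded_map_coords v : coords t (phi *m of_coords (coords t v)) = coords t (phi *m v).
Proof.
apply/ffunP => x; rewrite !ffunE; apply/eqP; rewrite -subr_eq0 -mcoeffB.
have -> : (phi *m of_coords (coords t v)) (val x).1 0 - (phi *m v) (val x).1 0 =
   (phi *m (of_coords (coords t v) - v)) (val x).1 0 by rewrite mulmxBr !mxE.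
apply/eqP/graded_map_coef0 => j m'.
rewrite (eqP (valP x)) => E.
have [y hy] := coords_in E.
by rewrite [fun_of_matrix _ _ _]mxE [X in _ + X]mxE mcoeffB !hy of_coordsK subrr.
Qed.

Definition piece_map (u : {ffun piece_basis c t -> K^o}) : {ffun piece_basis a t -> K^o} :=
  coords t (phi *m of_coords u).

Lemma piece_map_linear : linear piece_map.
Proof.
by move=> b u u'; rewrite /piece_map of_coords_lin mulmxDr -scalemxAr coords_lin.
Qed.

HB.instance Definition _ := GRing.isLinear.Build K _ _ _ piece_map piece_map_linear.

Lemma of_coords_piece_map u : of_coords (piece_map u) = phi *m of_coords u.
Proof. by apply/coordsK/graded_map_homog/of_coords_homog. Qed.

End OneMap.

Lemma dim_piece a t : dim {ffun piece_basis a t -> K^o} = #|piece_basis a t|.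
Proof. by rewrite -[RHS]muln1. Qed.

Section Resolution.
Variables (F : nat -> seq nat) (phi : forall i, 'M[S]_(size (F i), size (F i.+1))).
Hypothesis phi_exact : forall i (v : 'cV[S]_(size (F i.+1))),
  phi i *m v = 0 <-> exists w, v = phi i.+1 *m w.
Hypothesis phi_graded : forall i, graded_map (phi i).

(** The degree [t] part of an exact graded sequence is exact: boundaries of
    homogeneous vectors are boundaries of their homogeneous components. *)
Lemma hilbert_sum t N : F N.+1 = [::] ->
  (forall v : 'cV[S]_(size (F 0%N)), homogv t v -> exists w, v = phi 0%N *m w) ->
  \sum_(i < N.+1) (-1) ^+ i * #|piece_basis (F i) t|%:R = 0 :> rat.
Proof.
move=> FN surj.
pose V i : vectType K := {ffun piece_basis (F i) t -> K^o}.
pose f i : 'Hom(V i.+1, V i) := linfun (piece_map (phi i) (t := t)).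
have fE i u : f i u = coords t (phi i *m of_coords u) by rewrite lfunE.
have dE i u : of_coords (f i u) = phi i *m of_coords u.
  by rewrite lfunE /= of_coords_piece_map.
have := @euler_eq0 K V f _ _ N.
under eq_bigr => i _ do rewrite dim_piece.
rewrite dim_piece FN card_piece_basis0; apply=> //.
  move=> i; apply/vspaceP => u; rewrite memv_ker; apply/eqP/memv_imgP => [h|[w _ ->]].
    have /phi_exact [w hw] : phi i *m of_coords u = 0.
      rewrite -dE h; apply/matrixP => j k; rewrite !mxE big1 // => x _.
      by rewrite ffunE scale0r.
    exists (coords t w); first exact: memvf.
    by rewrite fE graded_map_coords // -hw of_coordsK.
  have e : phi i *m of_coords (f i.+1 w) = 0.
    by apply/phi_exact; exists (of_coords w); rewrite dE.
  by rewrite fE e; apply/ffunP => x; rewrite !ffunE mxE mcoeff0.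
apply/vspaceP => u; rewrite memvf.
have [w hw] := surj _ (of_coords_homog u).
apply/memv_imgP; exists (coords t w); first exact: memvf.
by rewrite fE graded_map_coords // -hw of_coordsK.
Qed.

End Resolution.
End GradedPieces.

Lemma card_piece_basis r a t : all (fun x => (x <= t)%N) a ->
  #|piece_basis r.+1 a t| = (\sum_(x <- a) 'C(t - x + r, r))%N.
Proof.
move=> /all_nthP ha; rewrite card_sig -sum1_card.
rewrite -(pair_big_dep predT (fun (j : 'I_(size a)) (m : 'X_{1..r.+1 < t.+1}) =>
   (nth 0%N a j + mdeg m == t)%N) (fun _ _ => 1%N)) /=.
rewrite (big_nth 0%N) big_mkord; apply: eq_bigr => j _.
have jt := ha 0%N j (ltn_ord j).
rewrite sum1_card -bin_sub ?leq_addl // addnK -(@size_basis r (t - nth 0%N a j)).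
rewrite cardE -(size_map (@bmnm _ _)).
apply/perm_size/uniq_perm.
- by rewrite map_inj_uniq ?enum_uniq //; exact: val_inj.
- exact: uniq_basis.
move=> m; rewrite -basis_cover; apply/mapP/eqP => [[x]|h].
  by rewrite mem_enum => /eqP h ->; exact: (canRL (addKn _) h).
have mt : (mdeg m < t.+1)%N by lia.
by exists (BMultinom mt) => //; rewrite mem_enum; apply/eqP; rewrite /= h subnKC.
Qed.

(** * Herzog-Kuehl equations and the bound *)

Section Numerics.
Variable r : nat.

(** r! times the polynomial that agrees with C(s + r, r), the dimension of the
    degree s part of S, for natural s. *)
Definition hilbert_poly : {poly rat} := \prod_(k < r) ('X + (k.+1%:R)%:P).

Lemma hilbert_poly_nat s : hilbert_poly.[s%:R] = ('C(s + r, r) * r`!)%:R.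
Proof.
rewrite horner_prod bin_ffact ffact_prod natr_prod (reindex_inj rev_ord_inj) /=.
apply: eq_bigr => k _; rewrite hornerD hornerX hornerC -natrD; congr _%:R.
by have := ltn_ord k; lia.
Qed.

(** Combinatorial reciprocity; for s < r both sides vanish. *)
Lemma hilbert_poly_neg s :
  hilbert_poly.[- s.+1%:R] = (-1) ^+ r * ('C(s, r) * r`!)%:R.
Proof.
rewrite horner_prod; have [sr|rs] := ltnP s r.
  rewrite bin_small // mul0n mulr0 (bigD1 (Ordinal sr)) //=.
  by rewrite hornerD hornerX hornerC addNr mul0r.
rewrite bin_ffact ffact_prod natr_prod -[r in _ ^+ r]card_ord -prodr_const -big_split /=.
apply: eq_bigr => k _; rewrite hornerD hornerX hornerC mulN1r natrB; last first.
  by apply: leq_trans rs; apply: ltnW.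
by rewrite -!natr1; ring.
Qed.

Variables (F : nat -> seq nat) (N T : nat).
Hypothesis F_bound : forall i, all (fun a => (a <= T)%N) (F i).
Hypothesis F_sum : forall t, (T <= t)%N ->
  \sum_(i < N) (-1) ^+ i * (\sum_(a <- F i) 'C(t - a + r, r))%N%:R = 0 :> rat.

(** The value at degree [D] of the polynomial in t that equals C(t - a + r, r) for
    t >= a.  Below the twist [a] it is, up to sign, the dimension of a graded piece
    of top local cohomology, which vanishes in the r degrees just below [a]. *)
Definition twist_value (D a : nat) : rat :=
  if (a <= D)%N then 'C(D - a + r, r)%:R else (-1) ^+ r * 'C(a - D.+1, r)%:R.

Lemma twist_valueE D a :
  hilbert_poly.[D%:R - a%:R] = twist_value D a * r`!%:R.
Proof.
rewrite /twist_value; case: leqP => h.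
  by rewrite -natrB // hilbert_poly_nat natrM.
rewrite -opprB -natrB 1?ltnW // -mulrA -natrM -hilbert_poly_neg.
by congr (_.[- _%:R]); lia.
Qed.

(** A polynomial in the degree that vanishes in all large degrees is zero. *)
Lemma twist_sum_eq0 D :
  \sum_(i < N) (-1) ^+ i * (\sum_(a <- F i) twist_value D a) = 0.
Proof.
pose G : {poly rat} := \sum_(i < N) (-1) ^+ i *:
   \sum_(a <- F i) (hilbert_poly \Po ('X - a%:R%:P)).
have GE x : G.[x] = \sum_(i < N) (-1) ^+ i * \sum_(a <- F i) hilbert_poly.[x - a%:R].
  rewrite horner_sum; apply: eq_bigr => i _; rewrite hornerZ horner_sum.
  by congr (_ * _); apply: eq_bigr => a _; rewrite horner_comp hornerXsubC.
have GD t : G.[t%:R] =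
    (\sum_(i < N) (-1) ^+ i * (\sum_(a <- F i) twist_value t a)) * r`!%:R.
  rewrite GE mulr_suml; apply: eq_bigr => i _; rewrite -mulrA mulr_suml.
  by congr (_ * _); apply: eq_bigr => a _; rewrite twist_valueE.
have rt t : (T <= t)%N -> root G t%:R.
  move=> Tt; rewrite /root GD; apply/eqP.
  rewrite -[RHS](mul0r r`!%:R) -[in RHS](F_sum Tt); congr (_ * _).
  apply: eq_bigr => i _; rewrite natr_sum; congr (_ * _).
  apply: eq_big_seq => a /(allP (F_bound i)) aT.
  by rewrite /twist_value (leq_trans aT Tt).
have G0 : G = 0.
  apply/eqP; apply: contraT => Gn0.
  have := max_poly_roots Gn0 (rs := [seq k%:R | k <- iota T (size G)]).
  rewrite size_map size_iota ltnn; apply.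
    by apply/allP => _ /mapP [k kT ->]; apply: rt; move: kT; rewrite mem_iota => /andP[].
  by rewrite map_inj_uniq ?iota_uniq // => x y /eqP; rewrite Num.Theory.eqr_nat => /eqP.
have /eqP := GD D; rewrite G0 horner0 eq_sym mulf_eq0 => /orP[/eqP //|].
by rewrite Num.Theory.pnatr_eq0 => /eqP h; have := fact_gt0 r; rewrite h.
Qed.
End Numerics.

Arguments almost_linear_twists : simpl never.

Section AlmostLinear.
Variables (r d : nat) (m : nat -> nat) (b : seq nat).
Hypothesis r_gt0 : (0 < r)%N.
Local Notation F := (almost_linear_twists r d.+1 m b).

Hypothesis F_twists : forall D,
  \sum_(i < r.+2) (-1) ^+ i * (\sum_(a <- F i) twist_value r D a) = 0.

Lemma twists_start D : \sum_(a <- F 0) twist_value r D a = 'C(D + r, r)%:R.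
Proof. by rewrite /almost_linear_twists /= big_seq1 /twist_value subn0. Qed.

Lemma twists_end D : (D <= d.+1)%N ->
  \sum_(a <- F r.+1) twist_value r D a =
    (-1) ^+ r * (\sum_(x <- b) 'C(d.+1 + r + x - D.+1, r))%N%:R.
Proof.
move=> hD; rewrite /almost_linear_twists /= ltnn eqxx big_map natr_sum mulr_sumr.
apply: eq_bigr => x _; rewrite /twist_value ifF //.
by apply/negbTE; rewrite -ltnNge; lia.
Qed.

Lemma twists_middle D i : (0 < i <= r)%N ->
  \sum_(a <- F i) twist_value r D a = (m i)%:R * twist_value r D (d + i)%N.
Proof.
move=> /andP[i0 ir]; rewrite /almost_linear_twists -[i == 0%N]negbK -lt0n i0 /= ir.
have -> : (d.+1 + i.-1 = d + i)%N by lia.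
by rewrite big_nseq iter_addr addr0 mulr_natl.
Qed.

(** Evaluation in degree [d], one below the degree d + 1 of the generators: the
    linear twists d + 1, ..., d + r lie at distance at most r above and contribute
    0. *)
Lemma socle_degrees_sum : (\sum_(x <- b) 'C(r + x, r))%N = 'C(d + r, r).
Proof.
have := F_twists d; rewrite big_ord_recl big_ord_recr /= [X in _ + (X + _)]big1 ?add0r; last first.
  move=> i _; rewrite twists_middle ?ltn_ord // /twist_value ifF; last first.
    by apply/negbTE; rewrite -ltnNge /bump /=; lia.
  rewrite bin_small ?mulr0 // /bump /=; have := ltn_ord i; lia.
rewrite /bump /= add1n twists_end // expr0 mul1r twists_start.
rewrite exprS mulrA -[_ * (-1) ^+ r]mulrA -exprD addnn -mul2n exprM sqrrN expr1n.
rewrite mulr1 mulN1r => /eqP; rewrite subr_eq0 Num.Theory.eqr_nat => /eqP ->.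
by apply: eq_bigr => x _; congr 'C(_, _); lia.
Qed.

(** Evaluation in the degree d + 1 of the generators: among the linear twists only
    the first one contributes. *)
Lemma generators_sum : (m 1%N + \sum_(x <- b) 'C(r + x - 1, r))%N = 'C(d.+1 + r, r).
Proof.
have := F_twists d.+1; rewrite big_ord_recl big_ord_recr /=.
rewrite [X in _ + (X + _)](bigD1 (Ordinal r_gt0)) //= [X in _ + (_ + X + _)]big1 ?addr0; last first.
  move=> i /eqP i0; rewrite twists_middle ?ltn_ord // /twist_value.
  have {}i0 : (0 < i)%N.
    by rewrite lt0n; apply/eqP => h; apply: i0; exact: val_inj.
  rewrite ifF; last by apply/negbTE; rewrite -ltnNge /bump /=; lia.
  rewrite bin_small ?mulr0 // /bump /=; have := ltn_ord i; lia.
rewrite /bump /= addn0 add1n twists_start twists_end // twists_middle // /twist_value addn1 leqnn.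
rewrite subnn add0n binn expr0 mul1r.
rewrite mulr1 expr1 mulN1r exprS mulrA -[_ * (-1) ^+ r]mulrA -exprD addnn -mul2n exprM sqrrN expr1n.
rewrite mulr1 mulN1r -opprD -natrD => /eqP; rewrite subr_eq0 Num.Theory.eqr_nat => /eqP ->.
by congr (_ + _)%N; apply: eq_bigr => x _; congr 'C(_, _); lia.
Qed.
End AlmostLinear.

Lemma ltn_bin_add r x y : (0 < r)%N -> ('C(r + x, r) < 'C(r + y, r))%N = (x < y)%N.
Proof.
case: r => // r _.
have step z : ('C(r.+1 + z, r.+1) < 'C(r.+1 + z.+1, r.+1))%N.
  by rewrite addnS binS -[ltnLHS]addn0 ltn_add2l bin_gt0; lia.
have mono : {mono (fun z => 'C(r.+1 + z, r.+1)) : x y / (x <= y)%N}.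
  by apply: leq_mono; apply: homo_ltn => // ? ? ?; apply: ltn_trans.
by rewrite !ltnNge mono.
Qed.

Section Count.
Variables (r d m1 : nat) (b : seq nat).
Hypothesis r_gt0 : (0 < r)%N.
Hypothesis socle_sum : (\sum_(x <- b) 'C(r + x, r))%N = 'C(d + r, r).
Hypothesis gen_sum : (m1 + \sum_(x <- b) 'C(r + x - 1, r))%N = 'C(d.+1 + r, r).

Let u x := 'C(r + x - 1, r - 1).

Lemma socle_degree_le x : x \in b -> (x <= d)%N.
Proof.
move=> xb; rewrite leqNgt -(ltn_bin_add d x r_gt0) -leqNgt [(r + d)%N]addnC -socle_sum.
by rewrite (big_rem x) //= leq_addr.
Qed.

Lemma generators_eq : m1 = ('C(d.+1 + r - 1, r - 1) + \sum_(x <- b) u x)%N.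
Proof.
have pascal n : (0 < n)%N -> 'C(n, r) = ('C(n - 1, r) + 'C(n - 1, r - 1))%N.
  by case: n => // n _; case: r r_gt0 => // r' _; rewrite !subn1 /= binS.
apply/eqP; rewrite -(eqn_add2r (\sum_(x <- b) 'C(r + x - 1, r))%N) gen_sum.
rewrite -addnA -big_split /= pascal ?addn_gt0 // addnC eqn_add2l addSn subn1 /= -socle_sum.
by apply/eqP/eq_bigr => x _; rewrite [in LHS]pascal ?addn_gt0 ?r_gt0 // addnC.
Qed.

(** As (r + x) C(r + x - 1, r - 1) = r C(r + x, r), weighting the summands by r + x
    turns the sum into the known sum of the C(r + x, r). *)
Lemma weighted_sum :
  ((r + d) * \sum_(x <- b) u x = (r + d) * u d + \sum_(x <- b) (d - x) * u x)%N.
Proof.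
have absorb x : ((r + x) * u x = r * 'C(r + x, r))%N.
  by rewrite /u !subn1 mul_bin_diag prednK.
rewrite absorb [X in 'C(X, _)]addnC -socle_sum !big_distrr /= -big_split /=.
rewrite !big_seq; apply: eq_bigr => x /socle_degree_le xd.
rewrite -absorb -mulnDl; congr (_ * _)%N; lia.
Qed.

(** By [weighted_sum] the excess over the bound is, up to the factor r + d, the sum
    of the (d - x) C(r + x - 1, r - 1), whose terms are nonnegative; it vanishes
    only if all x are d, and then [socle_sum] leaves room for a single one. *)
Lemma generator_bound : ('C(d.+1 + r - 1, r - 1) + 'C(d.+1 + r - 2, r - 1) <= m1)%N /\
  (m1 = ('C(d.+1 + r - 1, r - 1) + 'C(d.+1 + r - 2, r - 1))%N <-> size b = 1%N).
Proof.
have -> : (d.+1 + r - 2 = r + d - 1)%N by lia.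
rewrite generators_eq -/(u d); split.
  by rewrite leq_add2l -(leq_pmul2l (m := r + d)) ?addn_gt0 ?r_gt0 // weighted_sum leq_addr.
have -> : ('C(d.+1 + r - 1, r - 1) + \sum_(x <- b) u x =
    'C(d.+1 + r - 1, r - 1) + u d)%N <-> \sum_(x <- b) u x = u d.
  by split=> [/addnI|->].
have C0 : (0 < 'C(d + r, r))%N by rewrite bin_gt0 leq_addl.
split=> [E|sz].
  have /eqP := weighted_sum; rewrite E -[eqbLHS]addn0 eqn_add2l eq_sym.
  rewrite sum_nat_seq_eq0 => /allP h.
  have bd x : x \in b -> x = d.
    move=> xb; have := h x xb; rewrite muln_eq0 => /orP[|].
      by have := socle_degree_le xb; lia.
    by rewrite eqn0Ngt bin_gt0; lia.
  move: socle_sum; rewrite big_seq (eq_bigr (fun=> 'C(d + r, r))); last first.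
    by move=> x /bd ->; rewrite addnC.
  rewrite -big_seq big_const_seq count_predT iter_addn_0 => /eqP.
  by rewrite -[eqbRHS]muln1 eqn_pmul2l // => /eqP.
move: socle_sum; case: b sz => [|x []] //= _; rewrite !big_seq1 => E.
suff -> : x = d by [].
by have := ltn_bin_add x d r_gt0; have := ltn_bin_add d x r_gt0; rewrite E [(r + d)%N]addnC; lia.
Qed.
End Count.

(** * Simple socle means at most one last twist *)

Section SocleType.
Variables (K : fieldType) (n : nat).
Local Notation S := {mpoly K[n]}.
Variables (f : nat -> nat) (phi : forall i, 'M[S]_(f i, f i.+1)) (I : {pred S}).
Hypothesis phi_exact : forall i (v : 'cV[S]_(f i.+1)),
  phi i *m v = 0 <-> exists w, v = phi i.+1 *m w.
Hypothesis phi_minimal : forall i, minimal_map (phi i).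
Hypothesis f0 : f 0 = 1%N.
Hypothesis phi_coker : forall p,
  p \in I <-> exists w : 'cV[S]_(f 1%N), phi 0%N *m w = const_mx p.

Definition socle_poly (p : S) : Prop := forall i : 'I_n, 'X_i * p \in I.

(** The vector space of constant coefficients of F n has dimension at most one
    exactly when any two of its elements are proportional, and
    [socle_correspondence] carries this to the socle of S/I. *)
Lemma socle_poly_simple :
  (f n <= 1)%N <->
  (forall p q, socle_poly p -> socle_poly q -> p \notin I -> exists a, q - a * p \in I).
Proof.
have [L [Ladd Lnext Lzero Lprev]] := socle_correspondence phi_exact phi_minimal.
have colE (s : 'cV[S]_(f 0)) : exists p, s = const_mx p.
  have j : 'I_(f 0) by rewrite f0; exact: ord0.
  exists (s j 0); apply/matrixP => i k; rewrite ord1 mxE; congr (s _ _).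
  have f0' : (f 0 <= 1)%N by rewrite f0.
  by apply/val_inj; have := ltn_ord i; have := ltn_ord j; rewrite /=; lia.
have XE (i : 'I_n) p : 'X_i *: const_mx p = const_mx ('X_i * p) :> 'cV[S]_(f 0).
  by apply/matrixP => a k; rewrite !mxE.
have inI p : p \in I <-> exists v : 'cV[S]_(f 1%N), const_mx p = phi 0%N *m v.
  by split=> [/phi_coker|] [v hv]; [exists v|apply/phi_coker; exists v].
have socI p : socle_poly p <-> forall i : 'I_n, exists v : 'cV[S]_(f 1%N), 'X_i *: const_mx p = phi 0%N *m v.
  by split=> h i; [rewrite XE; apply/inI/h|apply/inI; rewrite -XE; apply: h].
have subE q p a : (const_mx q - a *: const_mx p : 'cV[S]_(f 0)) = const_mx (q - a * p).
  by apply/matrixP => i k; rewrite !mxE.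
have Lsub q p a w w' : L (const_mx p) w -> L (const_mx q) w' ->
    L (const_mx (q - a * p)) (w' - a *: w).
  move=> hp hq; have := Ladd (- a) _ _ _ _ hp hq.
  by rewrite !scaleNr ![- _ + _]addrC subE.
split=> [fn p q /socI /Lnext [w hw] /socI /Lnext [w' hw'] pI|simple].
  have [a wa] : exists a, (w a 0)@_(0%MM) <> 0.
    apply: boolp.contrapT => no; case/negP: pI; apply/inI/(Lzero _ _ hw) => a.
    by apply: boolp.contrapT => h; apply: no; exists a.
  pose c := (w' a 0)@_(0%MM) / (w a 0)@_(0%MM).
  exists c%:MP; apply/inI/(Lzero _ _ (Lsub _ _ c%:MP _ _ hw hw')) => a'.
  have -> : a' = a by apply/val_inj; have := ltn_ord a'; have := ltn_ord a; rewrite /=; lia.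
  rewrite [fun_of_matrix _ _ _]mxE [X in _ + X]mxE [X in - X]mxE mcoeffB mcoeffCM.
  by rewrite divfK ?subrr //; apply/eqP.
rewrite leqNgt; apply/negP => fn.
pose a0 : 'I_(f n) := Ordinal (ltnW fn); pose a1 : 'I_(f n) := Ordinal fn.
pose e a : 'cV[S]_(f n) := \col_i (i == a)%:R.
have [s0 hs0 /= ss0] := Lprev (e a0); have [s1 hs1 /= ss1] := Lprev (e a1).
have [p pE] := colE s0; have [q qE] := colE s1; subst s0 s1.
have const1 : (1 : S)@_(0%MM) <> 0 by rewrite mcoeff1 eqxx; apply/eqP/oner_neq0.
have pI : p \notin I.
  apply/negP => /inI /(Lzero _ _ hs0) /(_ a0); rewrite mxE eqxx; exact: const1.
have [a] := simple p q (proj2 (socI p) ss0) (proj2 (socI q) ss1) pI.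
move=> /inI /(Lzero _ _ (Lsub _ _ a _ _ hs0 hs1)) /(_ a1).
by rewrite !mxE eqxx mulr0 subr0; exact: const1.
Qed.
End SocleType.

(** * The quotient ring is local with a monomial filtration *)

Section Order.
Variables (K : fieldType) (n : nat).
Local Notation S := {mpoly K[n]}.

Definition order_ge (t : nat) (p : S) : Prop :=
  forall m, (mdeg m < t)%N -> p@_m = 0.

Lemma order_ge0 t : order_ge t 0.
Proof. by move=> m _; rewrite mcoeff0. Qed.

Lemma order_geD t p q : order_ge t p -> order_ge t q -> order_ge t (p + q).
Proof. by move=> hp hq m hm; rewrite mcoeffD hp // hq // addr0. Qed.

Lemma order_geM s t p q : order_ge s p -> order_ge t q -> order_ge (s + t) (p * q).
Proof.
move=> hp hq m hm; rewrite mcoeffM big1 // => k /eqP mE.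
have [h|h] := ltnP (mdeg k.1) s; first by rewrite hp // mul0r.
rewrite [q@__]hq ?mulr0 // -(ltn_add2l (mdeg k.1)) -mdegD -mE.
by apply: leq_trans hm _; rewrite leq_add2r.
Qed.

Lemma order_geMl t p q : order_ge t q -> order_ge t (p * q).
Proof. by move=> h; rewrite -[t]add0n; apply: order_geM => // m. Qed.

Lemma order_geX m : order_ge (mdeg m) 'X_[m].
Proof. by move=> k hk; rewrite mcoeffX; case: eqP => // mk; move: hk; rewrite mk ltnn. Qed.

Lemma order_ge_exp k q : order_ge 1 q -> order_ge k (q ^+ k).
Proof.
move=> hq; elim: k => [|k IH]; first by move=> m.
by rewrite exprS -[k.+1]add1n; apply: order_geM.
Qed.

Lemma order_ge_ind t (P : S -> Prop) p : P 0 -> (forall q q', P q -> P q' -> P (q + q')) ->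
  (forall c m, (t <= mdeg m)%N -> P (c *: 'X_[m])) -> order_ge t p -> P p.
Proof.
move=> P0 PD PX hp; rewrite [p]mpolyE big_seq; apply: big_ind => // m.
rewrite mcoeff_msupp => hm; apply: PX; rewrite leqNgt; apply/negP => /hp E.
by rewrite E eqxx in hm.
Qed.

Lemma mnm_split (m : 'X_{1..n}) : (0 < mdeg m)%N -> exists i m', m = (m' + U_(i))%MM.
Proof.
rewrite lt0n mdeg_eq0 => m0.
have [i mi] : exists i : 'I_n, m i <> 0%N.
  apply: boolp.contrapT => no; case/eqP: m0; apply/mnmP => i; rewrite mnm0E.
  by apply: boolp.contrapT => h; apply: no; exists i.
exists i, (m - U_(i))%MM; rewrite submK //.
by apply/mnm_lepP => k; rewrite mnm1E; case: eqP => // <-; rewrite lt0n; apply/eqP.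
Qed.

Section Quotient.
Variable I : idealr S.
Hypothesis hI : homogeneous_ideal I.
Local Notation A := {ideal_quot I}.
Local Notation pi p := (\pi_A%qT (p : S) : A).

Lemma pi_eqP p q : pi p = pi q <-> p - q \in I.
Proof. by rewrite Quotient.idealrBE; split=> /eqP. Qed.

Lemma pi_surj (x : A) : exists p, x = pi p.
Proof. by exists (repr x)%qT; rewrite reprK. Qed.

Lemma pi0 : pi 0 = 0. Proof. exact: rmorph0. Qed.
Lemma piD p q : pi (p + q) = pi p + pi q. Proof. exact: rmorphD. Qed.
Lemma piM p q : pi (p * q) = pi p * pi q. Proof. exact: rmorphM. Qed.
Lemma pi1 : pi 1 = 1. Proof. exact: rmorph1. Qed.

(** The component of degree mdeg m of the difference is the monomial. *)
Lemma leading_monomial m q :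
  order_ge (mdeg m).+1 q -> 'X_[m] - q \in I -> 'X_[m] \in I.
Proof.
move=> hq /(hI (mdeg m)); rewrite raddfB /= pihomogX eqxx.
suff -> : pihomog mdeg (mdeg m) q = 0 by rewrite subr0.
rewrite pihomogE big_seq_cond big1 // => k /andP[_ /eqP hk].
by rewrite hq ?scale0r // hk.
Qed.

Lemma ideal_monomialD m m' : 'X_[m] \in I -> 'X_[(m' + m)] \in I.
Proof. by move=> h; rewrite mpolyXD; apply: idealMr. Qed.

(** The power with exponent [t] of the irrelevant ideal, in the quotient. *)
Definition powm (t : nat) (x : A) : Prop := exists2 p, order_ge t p & x = pi p.

Lemma powm_lin t a x y : powm t x -> powm t y -> powm t (a * x + y).
Proof.
move=> [p hp ->] [q hq ->]; have [c ->] := pi_surj a.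
exists (c * p + q); last by rewrite piD piM.
by apply: order_geD => //; apply: order_geMl.
Qed.

Lemma powm0 t : powm t 0.
Proof. by exists 0; [exact: order_ge0|rewrite pi0]. Qed.

Lemma powmW t x : powm t.+1 x -> powm t x.
Proof. by case=> p hp ->; exists p => // m hm; apply: hp; apply: leq_trans hm _. Qed.

(** The powers of the irrelevant ideal cannot decrease strictly more often than
    the length allows; where two consecutive powers agree in the quotient, all
    monomials of that degree lie in I by [leading_monomial]. *)
Lemma finite_length_monomials :
  finite_length (A^o : lmodType A) ->
  exists T, forall m, (T <= mdeg m)%N -> 'X_[m] \in I.
Proof.
case=> l hl.
have [t ht] : exists t, forall x, powm t x -> powm t.+1 x.
  apply: boolp.contrapT => no.
  pose N i : {pred A^o} := fun x => boolp.asbool (powm (l.+1 - i) x).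
  suff : (l.+1 <= l)%N by rewrite ltnn.
  apply: (hl _ N); split=> i hi.
    split; first by apply/boolp.asboolP; exact: powm0.
    by move=> a x y /boolp.asboolP hx /boolp.asboolP hy; apply/boolp.asboolP/powm_lin.
  have E : (l.+1 - i = (l.+1 - i.+1).+1)%N by lia.
  split; first by move=> x /boolp.asboolP; rewrite E => /powmW h; apply/boolp.asboolP.
  apply: boolp.contrapT => no'; apply: no; exists (l.+1 - i.+1)%N => x hx.
  apply: boolp.contrapT => nx; apply: no'; exists x; first exact/boolp.asboolP.
  by apply/negP => /boolp.asboolP; rewrite E.
have top m : mdeg m = t -> 'X_[m] \in I.
  move=> mt; have [q hq /pi_eqP] : powm t.+1 (pi 'X_[m]).
    by apply: ht; exists 'X_[m] => //; rewrite -mt; exact: order_geX.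
  by apply: leading_monomial; rewrite mt.
exists t => m /subnK; move: (mdeg m - t)%N => k.
elim: k m => [|k IH] m; first by rewrite add0n => /esym; exact: top.
move=> mE; have [|i [m' mE']] := mnm_split (m := m); first by rewrite -mE addSn.
rewrite mE' addmC; apply/ideal_monomialD/IH.
by move: mE; rewrite mE' mdegD mdeg1; lia.
Qed.

Section Nilpotent.
Variable T : nat.
Hypothesis hT : forall m, (T <= mdeg m)%N -> 'X_[m] \in I.

Lemma order_ge_ideal p : order_ge T p -> p \in I.
Proof.
apply: (order_ge_ind (P := fun q => q \in I)); first exact: rpred0.
  by move=> q q' h h'; rewrite rpredD.
by move=> c m hm; rewrite -mul_mpolyC; apply/idealMr/hT.
Qed.

Definition level (t : nat) : seq A :=
  [seq pi 'X_[bmnm m] | m : 'X_{1..n < t.+1} <- enum {: 'X_{1..n < t.+1}} & mdeg (bmnm m) == t].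

(** Monomials by increasing degree, from [s] up to the bound [T] beyond which all
    monomials lie in I: the product of a monomial with a variable is in the span
    of the later levels, so this is a filtration. *)
Definition levels (s : nat) : seq A := flatten [seq level t | t <- iota s (T - s)].

Lemma levelP t x : reflect (exists2 m, mdeg m = t & x = pi 'X_[m]) (x \in level t).
Proof.
apply: (iffP mapP) => [[m]|[m mt ->]].
  by rewrite mem_filter => /andP[/eqP mt _] ->; exists m.
have ml : (mdeg m < t.+1)%N by rewrite mt.
by exists (BMultinom ml) => //; rewrite mem_filter /= mt eqxx mem_enum.
Qed.

Lemma levels_filtration s :
  (forall x, span (levels s) x <-> powm s x) /\ filtration (powm 1) (levels s).
Proof.
have [k Tsk] : exists k, (T <= s + k)%N by exists T; exact: leq_addl.
elim: k s Tsk => [|k IH] s.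
  rewrite addn0 => Ts; rewrite /levels; have -> : (T - s = 0)%N by lia.
  split=> // x; split=> [->|[p hp ->]]; first exact: powm0.
  rewrite /= -pi0; apply/pi_eqP; rewrite subr0; apply: order_ge_ideal => m hm.
  by apply: hp; apply: leq_trans hm Ts.
rewrite addnS -addSn => /IH [spanS filS].
have [Ts|sT] := leqP T s.
  rewrite /levels; have -> : (T - s = 0)%N by lia.
  split=> // x; split=> [->|[p hp ->]]; first exact: powm0.
  rewrite /= -pi0; apply/pi_eqP; rewrite subr0; apply: order_ge_ideal => m hm.
  by apply: hp; apply: leq_trans hm Ts.
have E : levels s = level s ++ levels s.+1.
  by rewrite /levels; have -> : (T - s = (T - s.+1).+1)%N by lia.
have lev x : x \in level s -> powm s x.
  by case/levelP => m ms ->; exists 'X_[m] => //; rewrite -ms; exact: order_geX.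
rewrite E; split=> [x|]; last first.
  apply: filtration_cat => // x a /lev [p hp ->] [q hq ->].
  apply/spanS; exists (q * p); last by rewrite piM.
  by rewrite -add1n; apply: order_geM.
split=> [|[p hp ->]].
  apply: span_sub; [exact: powm0|exact: powm_lin|].
  move=> y; rewrite mem_cat => /orP[/lev //|/span_mem /spanS]; exact: powmW.
apply: (order_ge_ind (P := fun p => span (level s ++ levels s.+1) (pi p))) hp.
- rewrite pi0; exact: span0.
- by move=> q q' h h'; rewrite piD -[pi q]mul1r; apply: span_lin.
move=> c m; rewrite -mul_mpolyC piM leq_eqVlt => /orP[/eqP sm|sm].
  by apply/spanM/span_catl/span_mem/levelP; exists m.
apply/spanM/span_catr/spanS; exists 'X_[m] => // l hl; apply: order_geX.
exact: leq_trans sm.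
Qed.

Local Notation mm := (span (levels 1)).

Lemma mmE x : mm x <-> powm 1 x.
Proof. exact: (levels_filtration 1).1. Qed.

Lemma mm_filtration : filtration mm (levels 1).
Proof. by apply: filtrationW (levels_filtration 1).2 => a /mmE. Qed.

(** A polynomial with constant coefficient c != 0 is c (1 - q) with q nilpotent in
    the quotient; its inverse is a finite geometric sum. *)
Lemma mm_local (x : A) : mm x \/ exists y, x * y = 1.
Proof.
have [p ->] := pi_surj x; have [p0|p0] := eqVneq p@_(0%MM) 0.
  left; apply/mmE; exists p => // m; rewrite ltnS leqn0 mdeg_eq0 => /eqP -> //.
right; pose c := p@_(0%MM); pose q : S := 1 - c^-1%:MP * p.
have hq : order_ge 1 q.
  move=> m; rewrite ltnS leqn0 mdeg_eq0 => /eqP ->.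
  by rewrite mcoeffB mcoeff1 eqxx mcoeffCM mulVf // subrr.
exists (pi (c^-1%:MP * \sum_(i < T) q ^+ i)); rewrite -piM -pi1; apply/pi_eqP.
have -> : p * (c^-1%:MP * \sum_(i < T) q ^+ i) - 1 = - q ^+ T.
  have -> : p * (c^-1%:MP * \sum_(i < T) q ^+ i) = (1 - q) * \sum_(i < T) q ^+ i.
    have -> : 1 - q = c^-1%:MP * p by rewrite /q opprB addrC subrK.
    by rewrite mulrCA mulrA.
  by rewrite -[1 - q]opprB mulNr -subrX1 opprB addrAC subrr sub0r.
by rewrite rpredN; apply/order_ge_ideal/order_ge_exp.
Qed.

Lemma socle_pi p : socle (levels 1) (pi p : A^o) <-> socle_poly I p.
Proof.
split=> [h i|h a /mmE [q hq ->]].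
  have /h : mm (pi 'X_i).
    by apply/mmE; exists 'X_i => //; rewrite -[1%N](mdeg1 i); exact: order_geX.
  by rewrite /GRing.scale /= -piM -pi0 => /pi_eqP; rewrite subr0.
rewrite /GRing.scale /= -piM -pi0; apply/pi_eqP; rewrite subr0.
apply: (order_ge_ind (P := fun q => q * p \in I)) hq.
- by rewrite mul0r rpred0.
- by move=> r r' hr hr'; rewrite mulrDl rpredD.
move=> c m /mnm_split [i [m' ->]]; rewrite mpolyXD -mul_mpolyC -!mulrA.
by do 2 apply: idealMr; apply: h.
Qed.

Lemma gorenstein_socle_poly : gorenstein_local A <->
  (forall p q, socle_poly I p -> socle_poly I q -> p \notin I -> exists a, q - a * p \in I).
Proof.
apply: (iff_trans (gorensteinP mm_local mm_filtration)).
split=> [h p q /socle_pi sp /socle_pi sq pI|h s t].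
  have [|x] := h _ _ sp sq.
    by rewrite -pi0 => /pi_eqP; rewrite subr0; exact/negP.
  by have [a ->] := pi_surj x; rewrite -piM => /pi_eqP; exists a.
have [p ->] := pi_surj s; have [q ->] := pi_surj t.
move=> /socle_pi sp /socle_pi sq s0; have [|a ha] := h p q sp sq.
  by apply/negP => pI; apply: s0; rewrite -pi0; apply/pi_eqP; rewrite subr0.
by exists (pi a); rewrite -piM; apply/pi_eqP.
Qed.

End Nilpotent.
End Quotient.
End Order.

(** * The theorem *)

Theorem proposition11p1 (K : fieldType) (r : nat) (hr : (2 <= r)%N)
    (I : idealr {mpoly K[r.+1]}) (hI : homogeneous_ideal I)
    (hfin : finite_length ({ideal_quot I}^o : lmodType {ideal_quot I}))
    (d : nat) (m : nat -> nat) (b : seq nat)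
    (phi : forall i : nat,
       'M[{mpoly K[r.+1]}]_(size (almost_linear_twists r d m b i),
                            size (almost_linear_twists r d m b i.+1)))
    (hres : minimal_graded_resolution I phi) :
  ('C(d + r - 1, r - 1) + 'C(d + r - 2, r - 1) <= m 1)%N /\
  (m 1%N = 'C(d + r - 1, r - 1) + 'C(d + r - 2, r - 1) <->
   gorenstein_local {ideal_quot I})%N.
Proof.
have [T hT] := finite_length_monomials hI hfin.
case: hres => _ coker exact graded minimal.
have r_gt0 : (0 < r)%N by apply: ltnW.
have gor := gorenstein_socle_poly hT.
have type := socle_poly_simple exact minimal erefl coker.
have szb : size (almost_linear_twists r d m b r.+1) = size b.
  by rewrite /almost_linear_twists /= ltnn eqxx size_map.
case: d => [|d] in phi coker exact graded minimal type szb *.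
  have : 'X_[U_(ord0) *+ T] \in I by apply: hT; rewrite mdegMn mdeg1 mul1n.
  (* For d = 0 the entries of phi 0 have degree 0, so minimality gives I = 0. *)
  move/coker => [w].
  have -> : phi 0%N = 0.
    apply/matrixP => i j; rewrite mxE; apply/mpolyP => k; rewrite mcoeff0.
    have [/graded|/memN_msupp_eq0 //] := boolP (k \in msupp (phi 0%N i j)).
    have all0 j' : nth 0%N (almost_linear_twists r 0 m b 1) j' = 0%N.
      by rewrite /almost_linear_twists /= r_gt0 nth_nseq; case: ifP.
    rewrite all0 => /eqP; rewrite addn_eq0 mdeg_eq0 => /andP[_ /eqP ->].
    exact: minimal.
  rewrite mul0mx => /matrixP /(_ ord0 ord0); rewrite !mxE.
  move/(congr1 (mcoeff (U_(ord0) *+ T)%MM)); rewrite mcoeffX eqxx mcoeff0 => /esym/eqP.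
  by rewrite oner_eq0.
pose F := almost_linear_twists r d.+1 m b.
pose B := maxn T (d.+1 + r + \sum_(x <- b) x)%N.
have bound i : all (fun a => (a <= B)%N) (F i).
  apply: (@sub_all _ (fun a => (a <= d.+1 + r + \sum_(x <- b) x)%N)).
    by move=> a h; rewrite leq_max h orbT.
  rewrite /F /almost_linear_twists; case: ifP => // i0; case: ifP => ir.
    by rewrite all_nseq; apply/orP; right; move: ir; lia.
  case: ifP => // _; apply/allP => _ /mapP [x xb ->].
  by rewrite leq_add2l (big_rem x) //= leq_addr.
have sums t : (B <= t)%N ->
    \sum_(i < r.+2) (-1) ^+ i * (\sum_(a <- F i) 'C(t - a + r, r))%N%:R = 0 :> rat.
  move=> Bt; have := @hilbert_sum K r.+1 F phi exact graded t r.+1.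
  under eq_bigr => i _.
    rewrite card_piece_basis; last by apply: sub_all (bound i) => a /leq_trans; apply.
    over.
  apply; first by rewrite /F /almost_linear_twists /= ltnNge leqnSn /= eqn_leq ltnn.
  move=> v hv; have /coker [w hw] : v 0 0 \in I.
    apply: (order_ge_ideal hT) => k kT; apply: hv => /=.
    by rewrite add0n => E; move: Bt; rewrite -E geq_max leqNgt kT.
  exists w; rewrite hw; apply/matrixP => i j.
  by rewrite !mxE !ord1.
have tw := twist_sum_eq0 bound sums.
have s1 := socle_degrees_sum r_gt0 tw.
have s2 := generators_sum r_gt0 tw.
have [-> eqv] := generator_bound r_gt0 s1 s2.
split=> //; apply: (iff_trans eqv); apply: iff_sym; apply: (iff_trans gor).
apply: (iff_trans (iff_sym type)); rewrite szb; split=> [|-> //].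
case: b s1 {bound sums tw s2 eqv type szb phi coker exact graded minimal F B} => [|x []] //.
by rewrite big_nil => /esym/eqP; rewrite eqn0Ngt bin_gt0 leq_addl.
Qed.
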